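(* Let $\mathfrak G=(\mathcal G_{-1}\oplus\mathcal G_0;\mathfrak l_1,\mathfrak l_2,\mathfrak l_3)$ be a graded bundle of Lie 2-algebras over a manifold $M$. Then $$(\mathrm{DER}^{-2}(\mathfrak G)\oplus\mathrm{DER}^{-1}(\mathfrak G)\oplus\mathrm{DER}^0(\mathfrak G);\ \mathbb j,\ \mathrm d,\ [\cdot,\cdot]_{\mathrm{DER}})$$ is a strict Lie 3-algebroid over $M$, where $\mathbb j$ is the anchor, $\mathrm d$ the differential and $[\cdot,\cdot]_{\mathrm{DER}}$ the bracket.
   Context: A graded bundle of Lie 2-algebras over $M$ is a graded vector bundle $\mathcal G_{-1}\oplus\mathcal G_0$ with $C^\infty(M)$-multilinear $\mathfrak l_1:\mathcal G_{-1}\to\mathcal G_0$, $\mathfrak l_2$ (skew-symmetric $\mathcal G_0\times\mathcal G_0\to\mathcal G_0$, with $\mathfrak l_2(u,m)=-\mathfrak l_2(m,u)\in\mathcal G_{-1}$, and zero on $\mathcal G_{-1}\times\mathcal G_{-1}$), and totally skew-symmetric $\mathfrak l_3:\wedge^3\mathcal G_0\to\mathcal G_{-1}$ such that for $w,x,y,z\in\Gamma(\mathcal G_0)$, $m,n\in\Gamma(\mathcal G_{-1})$: $\mathfrak l_1\mathfrak l_2(x,m)=\mathfrak l_2(x,\mathfrak l_1m)$; $\mathfrak l_2(\mathfrak l_1m,n)=\mathfrak l_2(m,\mathfrak l_1n)$; $\mathfrak l_1\mathfrak l_3(x,y,z)=\mathfrak l_2(x,\mathfrak l_2(y,z))-\mathfrak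 l_2(\mathfrak l_2(x,y),z)-\mathfrak l_2(y,\mathfrak l_2(x,z))$; $\mathfrak l_3(x,y,\mathfrak l_1m)=\mathfrak l_2(x,\mathfrak l_2(y,m))-\mathfrak l_2(\mathfrak l_2(x,y),m)-\mathfrak l_2(y,\mathfrak l_2(x,m))$; and $\mathfrak l_2(w,\mathfrak l_3(x,y,z))-\mathfrak l_2(x,\mathfrak l_3(w,y,z))+\mathfrak l_2(y,\mathfrak l_3(w,x,z))+\mathfrak l_2(\mathfrak l_3(w,x,y),z)-\mathfrak l_3(\mathfrak l_2(w,x),y,z)-\mathfrak l_3(x,\mathfrak l_2(w,y),z)-\mathfrak l_3(x,y,\mathfrak l_2(w,z))+\mathfrak l_3(w,\mathfrak l_2(x,y),z)+\mathfrak l_3(w,y,\mathfrak l_2(x,z))-\mathfrak l_3(w,x,\mathfrak l_2(y,z))=0$. A strict Lie $n$-algebroid is a graded vector bundle $\mathcal A=A_{-n+1}\oplus\cdots\oplus A_0$ over $M$ with a bundle map $\rho:A_0\to TM$, a $C^\infty(M)$-linear differential $l_1$ of degree $1$, and a graded skew-symmetric bracket $l_2$ of degree $0$ on sections ($l_2(x,y)=-(-1)^{|x||y|}l_2(y,x)$) such that $(\Gamma(\mathcal A);l_1,l_2)$ is a differential graded Lie algebra and $l_2(X^0,fY)=fl_2(X^0,Y)+\rho(X^0)(f)Y$ for $X^0\in\Gamma(A_0)$, $f\in C^\infty(M)$, $Y\in\Gamma(\mathcal A)$. For a vector bundle $E$, $\mathfrak D(E)$ is the bundle of covariant differential operators: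 its sections are $\mathbb R$-linear $D:\Gamma(E)\to\Gamma(E)$ for which there is a vector field (the symbol of $D$) with $D(fe)=fD(e)+(\text{symbol})(f)e$. Let $\mathbb j_0:\mathfrak D(\mathcal G_0)\to TM$, $\mathbb j_1:\mathfrak D(\mathcal G_{-1})\to TM$ be the symbol maps. A degree 0 derivation of $\mathfrak G$ is a triple $\mathfrak d=(\mathfrak d_0,\mathfrak d_1,l_{\mathfrak d})$ with $\mathfrak d_0\in\Gamma(\mathfrak D(\mathcal G_0))$, $\mathfrak d_1\in\Gamma(\mathfrak D(\mathcal G_{-1}))$, $l_{\mathfrak d}\in\Gamma(\mathrm{Hom}(\wedge^2\mathcal G_0,\mathcal G_{-1}))$ such that $\mathbb j_0(\mathfrak d_0)=\mathbb j_1(\mathfrak d_1)$, $\mathfrak d_0\circ\mathfrak l_1=\mathfrak l_1\circ\mathfrak d_1$, and for $u,v,w\in\Gamma(\mathcal G_0)$, $m\in\Gamma(\mathcal G_{-1})$: $\mathfrak d_0\mathfrak l_2(u,v)=\mathfrak l_2(\mathfrak d_0u,v)+\mathfrak l_2(u,\mathfrak d_0v)+\mathfrak l_1l_{\mathfrak d}(u,v)$; $\mathfrak d_1\mathfrak l_2(u,m)=\mathfrak l_2(\mathfrak d_0u,m)+\mathfrak l_2(u,\mathfrak d_1m)+l_{\mathfrak d}(u,\mathfrak l_1m)$; $l_{\mathfrak d}(u,\mathfrak l_2(v,w))+\mathfrak l_2(u,l_{\mathfrak d}(v,w))+\mathfrak l_3(\mathfrak d_0u,v,w)+\mathfrak l_3(u,\mathfrak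 d_0v,w)+\mathfrak l_3(u,v,\mathfrak d_0w)=\mathfrak d_1\mathfrak l_3(u,v,w)+l_{\mathfrak d}(\mathfrak l_2(u,v),w)+l_{\mathfrak d}(v,\mathfrak l_2(u,w))+\mathfrak l_2(l_{\mathfrak d}(u,v),w)+\mathfrak l_2(v,l_{\mathfrak d}(u,w))$. Degree 0 derivations are regarded as the sections of a vector bundle $\mathrm{Der}^0(\mathfrak G)$. Put $\mathrm{Der}^{-1}(\mathfrak G)=\mathrm{Hom}(\mathcal G_0,\mathcal G_{-1})$ and $\mathbb j(\mathfrak d_0,\mathfrak d_1,l_{\mathfrak d})=\mathbb j_0(\mathfrak d_0)$. For $u\in\Gamma(\mathcal G_0)$, $\mathrm{ad}^0_uv=\mathfrak l_2(u,v)$, $\mathrm{ad}^1_um=\mathfrak l_2(u,m)$, $l_{\mathrm{ad}_u}(v,w)=\mathfrak l_3(u,v,w)$; then $(\mathrm{ad}^0_u,\mathrm{ad}^1_u,l_{\mathrm{ad}_u})$ is a degree 0 derivation. Define $\delta(\phi)=(\mathfrak l_1\circ\phi,\phi\circ\mathfrak l_1,l_{\delta(\phi)})$ with $l_{\delta(\phi)}(u,v)=\phi(\mathfrak l_2(u,v))-\mathfrak l_2(\phi(u),v)-\mathfrak l_2(u,\phi(v))$ for $\phi\in\Gamma(\mathrm{Der}^{-1}(\mathfrak G))$; $[\mathfrak d,\mathfrak t]_{\mathrm{Der}}=([\mathfrak d_0,\mathfrak t_0]_C,[\mathfrak d_1,\mathfrak t_1]_C,l_{[\mathfrak d,\mathfrak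 t]_C})$, where $[\cdot,\cdot]_C$ is the commutator and $l_{[\mathfrak d,\mathfrak t]_C}(u,v)=\mathfrak d_1l_{\mathfrak t}(u,v)-l_{\mathfrak t}(\mathfrak d_0u,v)-l_{\mathfrak t}(u,\mathfrak d_0v)+l_{\mathfrak d}(\mathfrak t_0u,v)+l_{\mathfrak d}(u,\mathfrak t_0v)-\mathfrak t_1l_{\mathfrak d}(u,v)$; and $[\mathfrak d,\phi]_{\mathrm{Der}}=\mathfrak d_1\circ\phi-\phi\circ\mathfrak d_0$. Set $\mathrm{DER}^0(\mathfrak G)=\mathrm{Der}^0(\mathfrak G)$, $\mathrm{DER}^{-1}(\mathfrak G)=\mathrm{Der}^{-1}(\mathfrak G)\oplus\mathcal G_0$, $\mathrm{DER}^{-2}(\mathfrak G)=\mathcal G_{-1}$, and for $\mathfrak d,\mathfrak t\in\Gamma(\mathrm{Der}^0(\mathfrak G))$, $\phi,\psi\in\Gamma(\mathrm{Der}^{-1}(\mathfrak G))$, $u,v\in\Gamma(\mathcal G_0)$, $m\in\Gamma(\mathcal G_{-1})$: $\mathrm d(m)=-\mathfrak l_2(m,\cdot)+\mathfrak l_1(m)$, $\ \mathrm d(\phi+u)=\delta(\phi)+(\mathrm{ad}^0_u,\mathrm{ad}^1_u,l_{\mathrm{ad}_u})$, $[\mathfrak d,\mathfrak t]_{\mathrm{DER}}=[\mathfrak d,\mathfrak t]_{\mathrm{Der}}$, $\ [\mathfrak d,\phi+u]_{\mathrm{DER}}=[\mathfrak d,\phi]_{\mathrm{Der}}+l_{\mathfrak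 d}(u,\cdot)+\mathfrak d_0(u)$, $\ [\mathfrak d,m]_{\mathrm{DER}}=\mathfrak d_1(m)$, $\ [\phi+u,\psi+v]_{\mathrm{DER}}=\phi(v)+\psi(u)$; the remaining brackets are determined by graded skew-symmetry and vanish for degree reasons otherwise. *)

(* Defs.v *)
From HB Require Import structures.
From mathcomp Require Import all_boot all_order all_algebra.
From mathcomp Require Import all_classical all_reals all_analysis.
From mathcomp Require Import ring lra.

Set Implicit Arguments.
Unset Strict Implicit.
Unset Printing Implicit Defensive.

Import Order.TTheory GRing.Theory Num.Theory.
Import numFieldNormedType.Exports.
Local Open Scope classical_set_scope.
Local Open Scope ring_scope.

(* C^oo on the open set U: f and all its iterated directional derivatives are
   (Frechet) differentiable at every point of U. *)
Section SmoothEuclidean.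
Context {R : realType} {n : nat}.
Implicit Types (U : set 'rV[R]_n) (f g : 'rV[R]_n -> R).

Fixpoint ndiff (k : nat) U f : Prop :=
  if k is k'.+1 then
    (forall x, U x -> differentiable f x) /\ (forall v, ndiff k' U ('D_v f))
  else True.

Definition smooth_on U f : Prop := forall k, ndiff k U f.

Lemma near_eq_differentiable f g (x : 'rV[R]_n) :
  (\forall y \near x, f y = g y) -> differentiable f x -> differentiable g x.
Proof.
move=> fg df; pose h := g - f.
have hx : h x = 0 by rewrite /h !fctE (nbhs_singleton fg) subrr.
have h0 : \forall y \near (0 : 'rV[R]_n), h (y + x) = 0.
  have := fg; rewrite (near_shift 0 x) subr0 /=; apply: filterS => y /= fgy.
  by rewrite /h !fctE fgy subrr.
pose z : {linear 'rV[R]_n -> R} := \0.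
have eh : h \o shift x = cst (h x) + z +o_ (0 : 'rV[R]_n) id.
  apply/eqaddoP => _/posnumP[e]; apply: filterS h0 => y /= h0y.
  rewrite !fctE /= hx h0y addr0 subr0 normr0.
  by rewrite mulr_ge0.
have c0 : continuous z by apply: (@cst_continuous _ _ (0 : R)).
have dE : 'd h x = z :> ('rV[R]_n -> R) by exact: diff_unique.
have dh : differentiable h x.
  by apply/diff_locallyP; rewrite dE; split.
have -> : g = f + h by rewrite /h addrC subrK.
exact: differentiableD.
Qed.

Lemma ndiff_ext k U f g : open U -> (forall x, U x -> f x = g x) ->
  ndiff k U f -> ndiff k U g.
Proof.
move=> oU; elim: k f g => [//|k IH] f g fg [df Hf].
have nfg x : U x -> \forall y \near x, f y = g y.
  by move=> Ux; have := oU; rewrite openE => /(_ x Ux); apply: filterS.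
split=> [x Ux|v]; first exact: near_eq_differentiable (nfg x Ux) (df x Ux).
by apply: IH (Hf v) => x Ux; apply: near_eq_derive; exact: nfg.
Qed.

Lemma ndiffS k U U' f : U `<=` U' -> ndiff k U' f -> ndiff k U f.
Proof.
move=> sU; elim: k f => [//|k IH] f [df Hf]; split=> [x /sU|v]; first exact: df.
exact: IH (Hf v).
Qed.

Lemma ndiffW k U f : ndiff k.+1 U f -> ndiff k U f.
Proof.
elim: k f => [//|k IH] f [df Hf]; split=> // v; exact: IH (Hf v).
Qed.

Lemma ndiff_cst k U (c : R) : ndiff k U (cst c).
Proof.
elim: k c => [//|k IH] c; split=> [x _|v]; first exact: differentiable_cst.
have -> : 'D_v (cst c) = cst 0 :> ('rV[R]_n -> R) by apply/funext => x; exact: derive_cst.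
exact: IH.
Qed.

Lemma ndiffD k U f g : open U -> ndiff k U f -> ndiff k U g ->
  ndiff k U (fun x => f x + g x).
Proof.
move=> oU; elim: k f g => [//|k IH] f g [df Hf] [dg Hg]; split=> [x Ux|v].
  by apply: differentiableD; [exact: df|exact: dg].
apply: ndiff_ext (IH _ _ (Hf v) (Hg v)) => // x Ux.
by rewrite (@deriveD _ _ _ f g)//; apply: diff_derivable; [exact: df|exact: dg].
Qed.

Lemma ndiffM k U f g : open U -> ndiff k U f -> ndiff k U g ->
  ndiff k U (fun x => f x * g x).
Proof.
move=> oU; elim: k f g => [//|k IH] f g Hf0 Hg0.
have [df Hf] := Hf0; have [dg Hg] := Hg0; split=> [x Ux|v].
  by apply: differentiableM; [exact: df|exact: dg].
apply: ndiff_ext (ndiffD oU (IH _ _ (ndiffW Hf0) (Hg v))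
  (IH _ _ (ndiffW Hg0) (Hf v))) => // x Ux.
by rewrite (@deriveM _ _ f g)//; apply: diff_derivable; [exact: df|exact: dg].
Qed.

End SmoothEuclidean.

(* Charts are pairs of total functions; only their values on the domain and on
   its image are meaningful. *)
Record chart (R : realType) (T : topologicalType) (n : nat) := Chart {
  chart_dom : set T;
  chart_map : T -> 'rV[R]_n;
  chart_inv : 'rV[R]_n -> T }.

Section Chart.
Context {R : realType} {T : topologicalType} {n : nat}.
Implicit Types c : chart R T n.

Definition chart_im c : set 'rV[R]_n := chart_map c @` chart_dom c.

Record is_chart c : Prop := IsChart {
  chart_dom_open : open (chart_dom c);
  chart_im_open : open (chart_im c);
  chart_mapK : {in chart_dom c, cancel (chart_map c) (chart_inv c)};
  chart_map_cont : forall x, chart_dom c x -> {for x, continuous (chart_map c)};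
  chart_inv_cont : forall y, chart_im c y -> {for y, continuous (chart_inv c)} }.

Definition smooth_transition c c' : Prop := forall i : 'I_n,
  smooth_on (chart_map c @` (chart_dom c `&` chart_dom c'))
    (fun y => chart_map c' (chart_inv c y) 0 i).

End Chart.

Record manifold (R : realType) := Manifold {
  mcarrier :> topologicalType;
  mdim : nat;
  matlas : set (chart R mcarrier mdim);
  mhausdorff : hausdorff_space mcarrier;
  msecond_countable : @second_countable mcarrier;
  mchart : forall c, matlas c -> is_chart c;
  mcover : forall x : mcarrier, exists2 c, matlas c & chart_dom c x;
  mcompat : forall c c', matlas c -> matlas c' -> smooth_transition c c' }.

Section SmoothFunctions.
Context {R : realType} {M : manifold R}.
Implicit Types (W : set M) (f g : M -> R).

Definition smooth_fun W f : Prop := forall c, matlas c ->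
  smooth_on (chart_map c @` (chart_dom c `&` W)) (f \o chart_inv c).

Lemma chart_im_openI c W : matlas c -> open W ->
  open (chart_map c @` (chart_dom c `&` W)).
Proof.
move=> /mchart cc oW.
have -> : chart_map c @` (chart_dom c `&` W) =
    chart_im c `&` chart_inv c @^-1` W.
  apply/seteqP; split=> [_ [x [cx Wx] <-]|_ [[x cx <-]] /=].
    by split; [exists x|rewrite /= (chart_mapK cc) ?inE].
  by rewrite (chart_mapK cc) ?inE// => Wx; exists x.
rewrite openE => y [cy Wy]; apply: filterI.
  by have := chart_im_open cc; rewrite openE; apply.
apply: (chart_inv_cont cc cy); move: oW; rewrite openE; exact.
Qed.

Lemma smooth_fun_cst W (a : R) : smooth_fun W (cst a).
Proof. by move=> c _ k; exact: (ndiff_cst k _ a). Qed.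

Lemma smooth_funD W f g : open W -> smooth_fun W f -> smooth_fun W g ->
  smooth_fun W (fun x => f x + g x).
Proof.
move=> oW sf sg c cM k; have oI := chart_im_openI cM oW.
exact: ndiffD oI (sf c cM k) (sg c cM k).
Qed.

Lemma smooth_funM W f g : open W -> smooth_fun W f -> smooth_fun W g ->
  smooth_fun W (fun x => f x * g x).
Proof.
move=> oW sf sg c cM k; have oI := chart_im_openI cM oW.
exact: ndiffM oI (sf c cM k) (sg c cM k).
Qed.

Lemma smooth_funS W W' f : W `<=` W' -> smooth_fun W' f -> smooth_fun W f.
Proof.
move=> sW sf c cM k; apply: ndiffS (sf c cM k).
by apply: image_subset; exact: setIS.
Qed.

End SmoothFunctions.

(* The ring of smooth functions on M. *)
Section CInf.
Context {R : realType}.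
Variable M : manifold R.

Definition cinf_pred : pred (M -> R) := fun f => `[< smooth_fun setT f >].

Record cinf := CInf { cinf_val :> M -> R; _ : cinf_pred cinf_val }.
HB.instance Definition _ := [isSub for cinf_val].
HB.instance Definition _ := [Choice of cinf by <:].

Lemma cinf_smooth (f : cinf) : smooth_fun setT f.
Proof. by case: f => f /= /asboolP. Qed.

Lemma cinf_subring_closed : subring_closed cinf_pred.
Proof.
have N1 : smooth_fun setT (cst (-1) : M -> R) by exact: smooth_fun_cst.
split=> [|f g /asboolP sf /asboolP sg|f g /asboolP sf /asboolP sg].
- by apply/asboolP; exact: smooth_fun_cst.
- have -> : f - g = (fun x => f x + cst (-1) x * g x).
    by apply/funext => x; rewrite /= mulN1r.
  apply/asboolP; apply: smooth_funD => //; first exact: openT.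
  by apply: smooth_funM => //; exact: openT.
- by apply/asboolP; apply: smooth_funM => //; exact: openT.
Qed.

HB.instance Definition _ :=
  GRing.SubChoice_isSubComPzRing.Build _ _ cinf cinf_subring_closed.

Lemma cinf_cst_subproof (a : R) : cinf_pred (cst a).
Proof. by apply/asboolP; exact: smooth_fun_cst. Qed.
Definition cinf_cst (a : R) : cinf := CInf (cinf_cst_subproof a).

End CInf.
Arguments cinf_cst {R M} a.

(* A local trivialization of a family F of vector spaces over M identifies F x
   with R^r for each x in an open set; it is given here by total families of
   maps, of which only the values over the domain are meaningful. *)
Record triv (R : realType) (M : manifold R) (F : M -> vectType R) := Triv {
  tr_dom : set M;
  tr_rank : nat;
  tr_map : forall x, {linear F x -> 'rV[R]_tr_rank};
  tr_inv : forall x, 'rV[R]_tr_rank -> F x }.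
Arguments tr_map {R M F} t x.
Arguments tr_inv {R M F} t x.

Record is_triv (R : realType) (M : manifold R) (F : M -> vectType R)
    (t : triv F) : Prop := IsTriv {
  tr_dom_open : open (tr_dom t);
  tr_mapK : forall x, tr_dom t x -> cancel (tr_map t x) (tr_inv t x);
  tr_invK : forall x, tr_dom t x -> cancel (tr_inv t x) (tr_map t x) }.

(* The transition matrix from t to t' is smooth where both are defined. *)
Definition triv_compat (R : realType) (M : manifold R) (F : M -> vectType R)
    (t t' : triv F) : Prop :=
  forall (i : 'I_(tr_rank t)) (j : 'I_(tr_rank t')),
    smooth_fun (tr_dom t `&` tr_dom t')
      (fun x => tr_map t' x (tr_inv t x (delta_mx 0 i)) 0 j).

(* The rank is locally constant, hence constant on each component of M. *)
Record vbundle (R : realType) (M : manifold R) := VBundle {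
  vb_fibre : M -> vectType R;
  vb_atlas : set (triv vb_fibre);
  vb_triv : forall t, vb_atlas t -> is_triv t;
  vb_cover : forall x, exists2 t, vb_atlas t & tr_dom t x;
  vb_compat : forall t t', vb_atlas t -> vb_atlas t' -> triv_compat t t' }.

(* Arbitrary families of vectors, as a module over the smooth functions. *)
Section PreSections.
Context {R : realType} {M : manifold R}.
Variable E : vbundle M.

Definition presection := forall x : M, vb_fibre E x.
HB.instance Definition _ := Choice.copy presection (forall x, vb_fibre E x).

Implicit Types s t u : presection.

Let padd s t : presection := fun x => s x + t x.
Let popp s : presection := fun x => - s x.
Let pzero : presection := fun x => 0.
Let pscale (f : cinf M) s : presection := fun x => f x *: s x.

Let paddA : associative padd.
Proof. by move=> s t u; apply/functional_extensionality_dep => x; exact: addrA. Qed.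
Let paddC : commutative padd.
Proof. by move=> s t; apply/functional_extensionality_dep => x; exact: addrC. Qed.
Let padd0 : left_id pzero padd.
Proof. by move=> s; apply/functional_extensionality_dep => x; exact: add0r. Qed.
Let paddN : left_inverse pzero popp padd.
Proof. by move=> s; apply/functional_extensionality_dep => x; exact: addNr. Qed.

HB.instance Definition _ :=
  GRing.isZmodule.Build presection paddA paddC padd0 paddN.

Let pscaleA f g s : pscale f (pscale g s) = pscale (f * g) s.
Proof. by apply/functional_extensionality_dep => x; exact: scalerA. Qed.
Let pscale1 : left_id 1 pscale.
Proof. by move=> s; apply/functional_extensionality_dep => x; exact: scale1r. Qed.
Let pscaleDr : right_distributive pscale +%R.
Proof. by move=> f s t; apply/functional_extensionality_dep => x; exact: scalerDr. Qed.
Let pscaleDl s : {morph pscale^~ s : f g / f + g}.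
Proof. by move=> f g; apply/functional_extensionality_dep => x; exact: scalerDl. Qed.

HB.instance Definition _ := GRing.Zmodule_isLmodule.Build (cinf M) presection
  pscaleA pscale1 pscaleDr pscaleDl.

End PreSections.

(* The module of smooth sections. *)
Section Sections.
Context {R : realType} {M : manifold R}.
Variable E : vbundle M.

Definition smooth_section (s : presection E) : Prop :=
  forall t, vb_atlas t -> forall i,
    smooth_fun (tr_dom t) (fun x => tr_map t x (s x) 0 i).

Definition section_pred : pred (presection E) :=
  fun s => `[< smooth_section s >].

Record gamma := Gamma { gamma_val :> presection E; _ : section_pred gamma_val }.
HB.instance Definition _ := [isSub for gamma_val].
HB.instance Definition _ := [Choice of gamma by <:].

Lemma section_submod_closed : submod_closed section_pred.
Proof.
split=> [|f s t /asboolP Ss /asboolP St]; apply/asboolP => tr tE i.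
  have -> : (fun x => tr_map tr x ((0 : presection E) x) 0 i) = cst 0.
    by apply/funext => x; rewrite linear0 mxE.
  exact: smooth_fun_cst.
have -> : (fun x => tr_map tr x ((f *: s + t) x) 0 i) =
    (fun x => f x * tr_map tr x (s x) 0 i + tr_map tr x (t x) 0 i).
  by apply/funext => x; rewrite linearP !mxE.
have otr := tr_dom_open (vb_triv tE).
apply: smooth_funD => //; last exact: St.
apply: smooth_funM => //; last exact: Ss.
exact: smooth_funS (cinf_smooth f).
Qed.

HB.instance Definition _ := GRing.SubChoice_isSubLmodule.Build _ _ _ gamma
  (GRing.submod_closed_semi section_submod_closed).

End Sections.

(* Two sections are equal as soon as all R-valued additive maps agree on them;
   this reduces the identities below to the ring tactic. *)
Lemma gamma_sepP (R : realType) (M : manifold R) (E : vbundle M)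
  (s t : gamma E) : (forall h : {additive gamma E -> R}, h s = h t) -> s = t.
Proof.
move=> H; apply/val_inj/functional_extensionality_dep => x.
pose b := vbasis (fullv : {vspace vb_fibre E x}).
have Eb v : v = \sum_i coord b i v *: b`_i by exact/coord_vbasis/memvf.
rewrite [LHS]Eb [RHS]Eb; apply: eq_bigr => i _; congr (_ *: _).
pose h (u : gamma E) : R := coord b i (gamma_val u x).
have hB : {morph h : u v / u - v} by move=> u v; rewrite /h -raddfB.
pose hA := GRing.isZmodMorphism.Build _ _ h hB.
pose hh : {additive gamma E -> R} := HB.pack h hA.
exact: (H hh).
Qed.

Arguments gamma_val {R M E}.

Section Operators.
Context {R : realType} {M : manifold R}.
Notation C := (cinf M).
Implicit Types E F : vbundle M.

(* Vector fields are the derivations of the algebra of smooth functions. *)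
Definition is_derivation (X : C -> C) : Prop :=
  (forall (a : R) (f g : C),
    X (cinf_cst a * f + g) = cinf_cst a * X f + X g) /\
  (forall f g : C, X (f * g) = f * X g + X f * g).

Definition vfield_pred : pred (C -> C^o) := fun X => `[< is_derivation X >].

Record vfield := VField { vfield_val :> C -> C^o; _ : vfield_pred vfield_val }.
HB.instance Definition _ := [isSub for vfield_val].
HB.instance Definition _ := [Choice of vfield by <:].

Lemma vfieldP (X : vfield) : is_derivation X.
Proof. by case: X => X /= /asboolP. Qed.

Lemma vfield_submod_closed : submod_closed vfield_pred.
Proof.
split=> [|a X Y /asboolP [lX dX] /asboolP [lY dY]]; apply/asboolP.
  have E f : (0 : C -> C^o) f = 0 by [].
  by split=> [b f g|f g]; rewrite !E ?mulr0 ?mul0r addr0.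
have E f : (a *: X + Y) f = a * X f + Y f by [].
by split=> [b f g|f g]; rewrite !E ?lX ?lY ?dX ?dY; ring.
Qed.
HB.instance Definition _ := GRing.SubChoice_isSubLmodule.Build _ _ _ vfield
  (GRing.submod_closed_semi vfield_submod_closed).

(* Sections of Hom(E, F): C^oo(M)-linear maps on sections. *)
Definition hom_pred E F : pred (gamma E -> gamma F) := fun h => `[< linear h >].

Record hom E F := Hom { hom_val :> gamma E -> gamma F; _ : hom_pred hom_val }.
HB.instance Definition _ E F := [isSub for @hom_val E F].
HB.instance Definition _ E F := [Choice of hom E F by <:].

Lemma homP E F (h : hom E F) : linear h.
Proof. by case: h => h /= /asboolP. Qed.
HB.instance Definition _ E F (h : hom E F) :=
  GRing.isLinear.Build _ _ _ _ (hom_val h) (homP h).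

Lemma hom_submod_closed E F : submod_closed (@hom_pred E F).
Proof.
split=> [|a h k /asboolP lh /asboolP lk]; apply/asboolP.
  have E0 u : (0 : gamma E -> gamma F) u = 0 by [].
  by move=> b u v; rewrite !E0 scaler0 addr0.
have Ea u : (a *: h + k) u = a *: h u + k u by [].
move=> b u v; rewrite !Ea lh lk !scalerDr !scalerA [a * b]mulrC.
by rewrite addrACA.
Qed.
HB.instance Definition _ E F := GRing.SubChoice_isSubLmodule.Build _ _ _
  (hom E F) (GRing.submod_closed_semi (@hom_submod_closed E F)).

Lemma linear_hom_pred E F (f : gamma E -> gamma F) : linear f -> hom_pred f.
Proof. by move=> lf; exact/asboolP. Qed.
Definition mk_hom E F (f : gamma E -> gamma F) (lf : linear f) : hom E F :=
  Hom (linear_hom_pred lf).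

(* Sections of Hom(wedge^2 E, F): skew-symmetric C^oo(M)-bilinear maps. *)
Definition alt_pred E F : pred (gamma E -> gamma E -> gamma F) := fun b =>
  `[< (forall u, linear (b u)) /\ (forall u v, b u v = - b v u) >].

Record alt E F :=
  Alt { alt_val :> gamma E -> gamma E -> gamma F; _ : alt_pred alt_val }.
HB.instance Definition _ E F := [isSub for @alt_val E F].
HB.instance Definition _ E F := [Choice of alt E F by <:].

Lemma alt_linear E F (b : alt E F) u : linear (b u).
Proof. by case: b => b /= /asboolP[]. Qed.
Lemma alt_skew E F (b : alt E F) u v : b u v = - b v u.
Proof. by case: b => b /= /asboolP[]. Qed.
HB.instance Definition _ E F (b : alt E F) u :=
  GRing.isLinear.Build _ _ _ _ (alt_val b u) (alt_linear b u).

Lemma alt_submod_closed E F : submod_closed (@alt_pred E F).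
Proof.
split=> [|a b c /asboolP [lb sb] /asboolP [lc sc]]; apply/asboolP.
  have E0 u v : (0 : gamma E -> gamma E -> gamma F) u v = 0 by [].
  by split=> [u k v w|u v]; rewrite !E0 ?scaler0 ?addr0 ?oppr0.
have Ea u v : (a *: b + c) u v = a *: b u v + c u v by [].
split=> [u k v w|u v]; rewrite !Ea.
  by rewrite lb lc !scalerDr !scalerA [a * k]mulrC addrACA.
by rewrite sb sc scalerN opprD.
Qed.
HB.instance Definition _ E F := GRing.SubChoice_isSubLmodule.Build _ _ _
  (alt E F) (GRing.submod_closed_semi (@alt_submod_closed E F)).

(* Sections of the bundle of covariant differential operators of E. The symbol
   is part of the data: it is determined by the operator wherever E has positive
   rank, and the fibre of this bundle is the tangent space where E has rank 0. *)
Definition cdo_pred E : pred ((gamma E -> gamma E) * vfield) := fun D =>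
  `[< (forall (a : R) e e',
        D.1 (cinf_cst a *: e + e') = cinf_cst a *: D.1 e + D.1 e') /\
      (forall (f : C) e, D.1 (f *: e) = f *: D.1 e + (D.2 f : C) *: e) >].

Record cdo E :=
  CDO { cdo_val : (gamma E -> gamma E) * vfield; _ : cdo_pred cdo_val }.
HB.instance Definition _ E := [isSub for @cdo_val E].
HB.instance Definition _ E := [Choice of cdo E by <:].

Definition cdo_op E (D : cdo E) : gamma E -> gamma E := (cdo_val D).1.
Coercion cdo_op : cdo >-> Funclass.
Definition symbol E (D : cdo E) : vfield := (cdo_val D).2.

Lemma cdo_linear E (D : cdo E) (a : R) e e' :
  D (cinf_cst a *: e + e') = cinf_cst a *: D e + D e'.
Proof. by have [+ _] := asboolW (valP D); apply. Qed.
Lemma cdo_leibniz E (D : cdo E) (f : C) e :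
  D (f *: e) = f *: D e + (symbol D f : C) *: e.
Proof. by have [_ +] := asboolW (valP D); apply. Qed.

Lemma cinf_cst1 : cinf_cst 1 = 1 :> C.
Proof. exact/val_inj. Qed.
Lemma cinf_cstN1 : cinf_cst (-1) = -1 :> C.
Proof. exact/val_inj. Qed.

Lemma cdo_zmod E (D : cdo E) : zmod_morphism D.
Proof.
move=> e e'; rewrite addrC -scaleN1r -cinf_cstN1 cdo_linear cinf_cstN1.
by rewrite scaleN1r addrC.
Qed.
HB.instance Definition _ E (D : cdo E) :=
  GRing.isZmodMorphism.Build _ _ (cdo_op D) (@cdo_zmod E D).

Lemma cdo_submod_closed E : submod_closed (@cdo_pred E).
Proof.
split=> [|f D D' /asboolP [lD eD] /asboolP [lD' eD']]; apply/asboolP.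
  have E1 e : (0 : (gamma E -> gamma E) * vfield).1 e = 0 by [].
  have E2 f : (0 : (gamma E -> gamma E) * vfield).2 f = 0 :> C by [].
  by split=> [a e e'|f e]; rewrite ?E1 ?E2 scaler0 ?scale0r addr0.
have E1 e : (f *: D + D').1 e = f *: D.1 e + D'.1 e by [].
have E2 g : (f *: D + D').2 g = f * (D.2 g : C) + D'.2 g :> C by [].
split=> [a e e'|g e].
  by rewrite !E1 lD lD' !scalerDr !scalerA [f * _]mulrC addrACA.
by rewrite !E1 E2 eD eD' !scalerDr !scalerA scalerDl [f * g]mulrC addrACA.
Qed.
HB.instance Definition _ E := GRing.SubChoice_isSubLmodule.Build _ _ _
  (cdo E) (GRing.submod_closed_semi (@cdo_submod_closed E)).

Lemma vfieldLE (a : C) (X Y : vfield) (f : C) :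
  (a *: X + Y) f = a * X f + Y f :> C.
Proof. by []. Qed.
Lemma homLE E F a (h k : hom E F) u : (a *: h + k) u = a *: h u + k u.
Proof. by []. Qed.
Lemma altLE E F a (b c : alt E F) u v : (a *: b + c) u v = a *: b u v + c u v.
Proof. by []. Qed.
Lemma cdoLE E a (D D' : cdo E) e : (a *: D + D') e = a *: D e + D' e.
Proof. by []. Qed.
Lemma symbolLE E a (D D' : cdo E) :
  symbol (a *: D + D') = a *: symbol D + symbol D'.
Proof. by []. Qed.

Lemma vfield_zmod (X : vfield) : zmod_morphism X.
Proof.
move=> f g; rewrite addrC -mulN1r -cinf_cstN1 (vfieldP X).1 cinf_cstN1.
by rewrite mulN1r addrC.
Qed.
HB.instance Definition _ (X : vfield) :=
  GRing.isZmodMorphism.Build C C^o (vfield_val X) (vfield_zmod X).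

Lemma vbr_subproof (X Y : vfield) :
  vfield_pred (fun f => X (Y f) - Y (X f)).
Proof.
have [[lX dX] [lY dY]] := (vfieldP X, vfieldP Y).
apply/asboolP; split=> [a f g|f g]; first by rewrite !lX !lY !lX; ring.
by rewrite dX dY !raddfD /= !dX !dY; ring.
Qed.
(* The Lie bracket of vector fields. *)
Definition vbr (X Y : vfield) : vfield := VField (vbr_subproof X Y).

Lemma cdo_br_subproof E (D D' : cdo E) :
  cdo_pred (fun e => D (D' e) - D' (D e), vbr (symbol D) (symbol D')).
Proof.
apply/asboolP; split=> [a e e'|f e] /=.
  rewrite !cdo_linear scalerBr opprD !addrA; congr (_ + _); rewrite -!addrA.
  by congr (_ + _); rewrite addrC.
apply: gamma_sepP => h; rewrite !cdo_leibniz !raddfD /= !cdo_leibniz.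
by rewrite !raddfN /= !raddfD /= !scalerDl !scaleNr !raddfD !raddfN /=; ring.
Qed.
(* The commutator [D, D']_C. *)
Definition cdo_br E (D D' : cdo E) : cdo E := CDO (cdo_br_subproof D D').

Lemma cdo_lin_subproof E (h : hom E E) : cdo_pred (h : _ -> _, 0 : vfield).
Proof.
apply/asboolP; split=> [a e e'|f e] /=; first exact: linearP.
by rewrite linearZ -[LHS]addr0; congr (_ + _); apply/esym; exact: scale0r.
Qed.
(* Endomorphisms of E, as differential operators with symbol 0. *)
Definition cdo_lin E (h : hom E E) : cdo E := CDO (cdo_lin_subproof h).

End Operators.
Arguments vfield {R} M.
Arguments hom_pred {R M} E F.
Arguments alt_pred {R M} E F.

(* Graded bundles of Lie 2-algebras: Gm1 and G0 sit in degrees -1 and 0. The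
   bracket of G0 with Gm1 is l2m; l2(m, u) is written - l2m u m. *)
Record lie2 (R : realType) (M : manifold R) := Lie2 {
  Gm1 : vbundle M;
  G0 : vbundle M;
  l1 : {linear gamma Gm1 -> gamma G0};
  l2 : gamma G0 -> gamma G0 -> gamma G0;
  l2m : gamma G0 -> gamma Gm1 -> gamma Gm1;
  l3 : gamma G0 -> gamma G0 -> gamma G0 -> gamma Gm1;
  l2_linear : forall u, linear (l2 u);
  l2_skew : forall u v, l2 u v = - l2 v u;
  l2m_linear : forall u, linear (l2m u);
  l2m_linearl : forall m, linear (l2m ^~ m);
  l3_linear : forall u v, linear (l3 u v);
  l3_skew12 : forall u v w, l3 u v w = - l3 v u w;
  l3_skew23 : forall u v w, l3 u v w = - l3 u w v;
  l1_l2m : forall x m, l1 (l2m x m) = l2 x (l1 m);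
  l2m_l1 : forall m n, l2m (l1 m) n = - l2m (l1 n) m;
  l1_l3 : forall x y z,
    l1 (l3 x y z) = l2 x (l2 y z) - l2 (l2 x y) z - l2 y (l2 x z);
  l3_l1 : forall x y m,
    l3 x y (l1 m) = l2m x (l2m y m) - l2m (l2 x y) m - l2m y (l2m x m);
  l3_coh : forall w x y z,
    l2m w (l3 x y z) - l2m x (l3 w y z) + l2m y (l3 w x z)
      - l2m z (l3 w x y)
      - l3 (l2 w x) y z - l3 x (l2 w y) z - l3 x y (l2 w z)
      + l3 w (l2 x y) z + l3 w y (l2 x z) - l3 w x (l2 y z) = 0 }.
Arguments l1 {R M} G : rename.
Arguments l2 {R M} G : rename.
Arguments l2m {R M} G : rename.
Arguments l3 {R M} G : rename.

Section Derivations.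
Context {R : realType} {M : manifold R}.
Variable G : lie2 M.
Notation C := (cinf M).
Notation G0 := (G0 G).
Notation Gm1 := (Gm1 G).
Notation l1 := (l1 G).
Notation l2 := (l2 G).
Notation l2m := (l2m G).
Notation l3 := (l3 G).

HB.instance Definition _ u :=
  GRing.isLinear.Build _ _ _ _ (l2 u) (l2_linear u).
HB.instance Definition _ u :=
  GRing.isLinear.Build _ _ _ _ (l2m u) (l2m_linear u).
HB.instance Definition _ u v :=
  GRing.isLinear.Build _ _ _ _ (l3 u v) (l3_linear u v).

Record is_der0 (d0 : cdo G0) (d1 : cdo Gm1) (l : alt G0 Gm1) : Prop := IsDer0 {
  der_symbol : symbol d0 = symbol d1;
  der_l1 : forall m, d0 (l1 m) = l1 (d1 m);
  der_l2 : forall u v, d0 (l2 u v) = l2 (d0 u) v + l2 u (d0 v) + l1 (l u v);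
  der_l2m : forall u m,
    d1 (l2m u m) = l2m (d0 u) m + l2m u (d1 m) + l u (l1 m);
  der_l3 : forall u v w,
    l u (l2 v w) + l2m u (l v w)
      + l3 (d0 u) v w + l3 u (d0 v) w + l3 u v (d0 w)
    = d1 (l3 u v w) + l (l2 u v) w + l v (l2 u w)
      - l2m w (l u v) + l2m v (l u w) }.

Definition der0_pred : pred (cdo G0 * cdo Gm1 * alt G0 Gm1) :=
  fun d => `[< is_der0 d.1.1 d.1.2 d.2 >].

Record der0 := Der0 {
  der0_val : cdo G0 * cdo Gm1 * alt G0 Gm1;
  _ : der0_pred der0_val }.
HB.instance Definition _ := [isSub for der0_val].
HB.instance Definition _ := [Choice of der0 by <:].

Definition der_op0 (d : der0) : cdo G0 := (der0_val d).1.1.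
Definition der_op1 (d : der0) : cdo Gm1 := (der0_val d).1.2.
Definition der_alt (d : der0) : alt G0 Gm1 := (der0_val d).2.

Lemma der0P (d : der0) : is_der0 (der_op0 d) (der_op1 d) (der_alt d).
Proof. exact: asboolW (valP d). Qed.

Lemma linD_of (U V : lmodType C) (f : U -> V) : linear f ->
  {morph f : x y / x + y}.
Proof. by move=> lf x y; have := lf 1 x y; rewrite !scale1r. Qed.
Lemma linN_of (U V : lmodType C) (f : U -> V) : linear f -> {morph f : x / - x}.
Proof.
move=> lf x; have D := linD_of lf; apply: (addIr (f x)).
rewrite -D !addNr; apply: (addIr (f 0)); by rewrite -D !add0r.
Qed.
Lemma linZ_of (U V : lmodType C) (f : U -> V) : linear f -> scalable f.
Proof.
move=> lf a x; have D := linD_of lf.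
have f0 : f 0 = 0 by apply: (addIr (f 0)); rewrite -D !add0r.
by have := lf a x 0; rewrite f0 !addr0.
Qed.

Lemma l2_linearl v : linear (l2 ^~ v).
Proof.
move=> a u u'; rewrite l2_skew linearP [l2 u v]l2_skew [l2 u' v]l2_skew.
by rewrite scalerN opprD.
Qed.
Lemma l3_linear2 u w : linear (fun v => l3 u v w).
Proof.
move=> a v v'; rewrite l3_skew23 linearP [l3 u v w]l3_skew23.
by rewrite [l3 u v' w]l3_skew23 scalerN opprD.
Qed.
Lemma l3_linear1 v w : linear (fun u => l3 u v w).
Proof.
move=> a u u'; rewrite l3_skew12 l3_linear2 [l3 u v w]l3_skew12.
by rewrite [l3 u' v w]l3_skew12 scalerN opprD.
Qed.
Lemma alt_linearl (b : alt G0 Gm1) v : linear (b ^~ v).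
Proof.
move=> a u u'; rewrite alt_skew linearP [b u v]alt_skew [b u' v]alt_skew.
by rewrite scalerN opprD.
Qed.

Lemma l2Dl x y v : l2 (x + y) v = l2 x v + l2 y v.
Proof. exact: linD_of (l2_linearl v) x y. Qed.
Lemma l2Nl x v : l2 (- x) v = - l2 x v.
Proof. exact: linN_of (l2_linearl v) x. Qed.
Lemma l2Zl a x v : l2 (a *: x) v = a *: l2 x v.
Proof. exact: linZ_of (l2_linearl v) a x. Qed.
Lemma l2mDl x y m : l2m (x + y) m = l2m x m + l2m y m.
Proof. exact: linD_of (@l2m_linearl _ _ G m) x y. Qed.
Lemma l2mNl x m : l2m (- x) m = - l2m x m.
Proof. exact: linN_of (@l2m_linearl _ _ G m) x. Qed.
Lemma l2mZl a x m : l2m (a *: x) m = a *: l2m x m.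
Proof. exact: linZ_of (@l2m_linearl _ _ G m) a x. Qed.
Lemma l3_1Dl x y v w : l3 (x + y) v w = l3 x v w + l3 y v w.
Proof. exact: linD_of (l3_linear1 v w) x y. Qed.
Lemma l3_1Nl x v w : l3 (- x) v w = - l3 x v w.
Proof. exact: linN_of (l3_linear1 v w) x. Qed.
Lemma l3_1Zl a x v w : l3 (a *: x) v w = a *: l3 x v w.
Proof. exact: linZ_of (l3_linear1 v w) a x. Qed.
Lemma l3_2Dl x y u w : l3 u (x + y) w = l3 u x w + l3 u y w.
Proof. exact: linD_of (l3_linear2 u w) x y. Qed.
Lemma l3_2Nl x u w : l3 u (- x) w = - l3 u x w.
Proof. exact: linN_of (l3_linear2 u w) x. Qed.
Lemma l3_2Zl a x u w : l3 u (a *: x) w = a *: l3 u x w.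
Proof. exact: linZ_of (l3_linear2 u w) a x. Qed.
Lemma altDl x y (b : alt G0 Gm1) v : b (x + y) v = b x v + b y v.
Proof. exact: linD_of (alt_linearl b v) x y. Qed.
Lemma altNl x (b : alt G0 Gm1) v : b (- x) v = - b x v.
Proof. exact: linN_of (alt_linearl b v) x. Qed.
Lemma altZl a x (b : alt G0 Gm1) v : b (a *: x) v = a *: b x v.
Proof. exact: linZ_of (alt_linearl b v) a x. Qed.
Definition addlE := (l2Dl, l2mDl, l3_1Dl, l3_2Dl, altDl, l2Nl, l2mNl, l3_1Nl, l3_2Nl, altNl).
Definition scalelE := (l2Zl, l2mZl, l3_1Zl, l3_2Zl, altZl).

Local Ltac push := repeat (progress rewrite ?addlE ?raddfD ?raddfN /=).

Lemma der0_submod_closed : submod_closed der0_pred.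
Proof.
split=> [|a d t /asboolP dD /asboolP tD]; apply/asboolP.
  have E0 u : (0 : cdo G0) u = 0 by [].
  have E1 u : (0 : cdo Gm1) u = 0 by [].
  have E2 u v : (0 : alt G0 Gm1) u v = 0 by [].
  have Z1 v : l2 0 v = 0 by have := l2Zl 0 0 v; rewrite !scale0r.
  have Z2 v : l2m 0 v = 0 by have := l2mZl 0 0 v; rewrite !scale0r.
  have Z3 v w : l3 0 v w = 0 by have := l3_1Zl 0 0 v w; rewrite !scale0r.
  have Z4 v w : l3 v 0 w = 0 by have := l3_2Zl 0 0 v w; rewrite !scale0r.
  split=> [//|m|u v|u m|u v w]; rewrite ?E0 ?E1 ?E2 ?linear0 ?Z1 ?Z2 ?Z3 ?Z4 ?subr0 ?addr0 //.
have -> : (a *: d + t).1.1 = a *: d.1.1 + t.1.1 by [].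
have -> : (a *: d + t).1.2 = a *: d.1.2 + t.1.2 by [].
have -> : (a *: d + t).2 = a *: d.2 + t.2 by [].
split=> [|m|u v|u m|u v w].
- by rewrite !symbolLE (der_symbol dD) (der_symbol tD).
- by rewrite !cdoLE linearP (der_l1 dD) (der_l1 tD).
- apply: gamma_sepP => h; rewrite !cdoLE altLE (der_l2 dD) (der_l2 tD).
  by rewrite !addlE !scalelE !scalerDr !raddfD /= !linearZ /=; ring.
- apply: gamma_sepP => h; rewrite !cdoLE altLE (der_l2m dD) (der_l2m tD).
  by rewrite !addlE !scalelE !scalerDr !raddfD /= !linearZ /=; ring.
- apply: gamma_sepP => h.
  have := congr1 (fun x => h (a *: x)) (der_l3 dD u v w).
  have := congr1 h (der_l3 tD u v w).
  rewrite !cdoLE !altLE !addlE !scalelE !raddfD /= !linearZ /=.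
  by rewrite ?scalerDr ?raddfN /= ?raddfN; lra.
Qed.
HB.instance Definition _ := GRing.SubChoice_isSubLmodule.Build _ _ _ der0
  (GRing.submod_closed_semi der0_submod_closed).

Definition anchor (d : der0) : vfield M := symbol (der_op0 d).

Lemma ad_alt_subproof u : alt_pred G0 Gm1 (l3 u).
Proof. by apply/asboolP; split; [exact: l3_linear|exact: l3_skew23]. Qed.
Definition ad0 u : cdo G0 := cdo_lin (mk_hom (l2_linear u)).
Definition ad1 u : cdo Gm1 := cdo_lin (mk_hom (l2m_linear u)).
Definition ad_alt u : alt G0 Gm1 := Alt (ad_alt_subproof u).

Lemma ad_subproof x : der0_pred (ad0 x, ad1 x, ad_alt x).
Proof.
apply/asboolP; split=> //= [m|u v|u m|u v w]; rewrite -?[ad0 x _]/(l2 x _)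
  -?[ad1 x _]/(l2m x _) -?[ad_alt x _ _]/(l3 x _ _).
- by rewrite l1_l2m.
- by apply: gamma_sepP => h; rewrite l1_l3 !raddfD !raddfN /=; ring.
- by apply: gamma_sepP => h; rewrite l3_l1 !raddfD !raddfN /=; ring.
- apply: gamma_sepP => h; have := congr1 h (l3_coh x u v w).
  by rewrite !raddfD !raddfN raddf0 /=; lra.
Qed.
Definition ad u : der0 := Der0 (ad_subproof u).

(* The differential delta(phi) of phi in Der^{-1}. *)
Lemma delta0_linear (phi : hom G0 Gm1) : linear (l1 \o phi).
Proof. by move=> a u v; rewrite /= !linearP. Qed.
Lemma delta1_linear (phi : hom G0 Gm1) : linear (phi \o l1).
Proof. by move=> a u v; rewrite /= !linearP. Qed.
Lemma delta_alt_subproof (phi : hom G0 Gm1) : alt_pred G0 Gm1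
  (fun u v => phi (l2 u v) + l2m v (phi u) - l2m u (phi v)).
Proof.
apply/asboolP; split=> [u a v w|u v]; apply: gamma_sepP => h.
  rewrite !(l2mDl, l2mZl) !scalerDr ?scalerN !raddfD !raddfN /= !linearZ /=.
  ring.
by rewrite l2_skew; push; ring.
Qed.
Definition delta0 phi : cdo G0 := cdo_lin (mk_hom (delta0_linear phi)).
Definition delta1 phi : cdo Gm1 := cdo_lin (mk_hom (delta1_linear phi)).
Definition delta_alt phi : alt G0 Gm1 := Alt (delta_alt_subproof phi).

Lemma delta_subproof phi : der0_pred (delta0 phi, delta1 phi, delta_alt phi).
Proof.
apply/asboolP; split=> //= [u v|u m|u v w];
  rewrite -?[delta0 phi _]/(l1 (phi _)) -?[delta1 phi _]/(phi (l1 _))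
    -?[delta_alt phi _ _]/(phi (l2 _ _) + l2m _ (phi _) - l2m _ (phi _)).
- apply: gamma_sepP => h; push; rewrite !l1_l2m [l2 (l1 _) v]l2_skew.
  by push; ring.
- apply: gamma_sepP => h; rewrite l1_l2m l2m_l1.
  by push; ring.
- have -> : l3 (l1 (phi u)) v w = l3 v w (l1 (phi u)).
    by rewrite l3_skew12 l3_skew23 opprK.
  rewrite [l3 u (l1 _) w]l3_skew23 !l3_l1 l1_l3.
  by apply: gamma_sepP => h; push; ring.
Qed.
Definition delta phi : der0 := Der0 (delta_subproof phi).

(* The bracket [d, t]_Der. *)
Lemma der_br_alt_subproof (d t : der0) : alt_pred G0 Gm1 (fun u v =>
  der_op1 d (der_alt t u v) - der_alt t (der_op0 d u) v
  - der_alt t u (der_op0 d v) + der_alt d (der_op0 t u) v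
  + der_alt d u (der_op0 t v) - der_op1 t (der_alt d u v)).
Proof.
have dS := der_symbol (der0P d); have tS := der_symbol (der0P t).
apply/asboolP; split=> [u a v w|u v]; apply: gamma_sepP => h.
  push; rewrite !linearZ !cdo_leibniz; push.
  by rewrite !linearZ dS tS; push; ring.
rewrite [der_alt t u v]alt_skew [der_alt d u v]alt_skew.
rewrite [der_alt t _ v]alt_skew [der_alt d _ v]alt_skew.
rewrite [der_alt t u (der_op0 _ _)]alt_skew [der_alt d u (der_op0 _ _)]alt_skew.
by push; ring.
Qed.
Definition der_br0 (d t : der0) : cdo G0 := cdo_br (der_op0 d) (der_op0 t).
Definition der_br1 (d t : der0) : cdo Gm1 := cdo_br (der_op1 d) (der_op1 t).
Definition der_br_alt (d t : der0) : alt G0 Gm1 :=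
  Alt (der_br_alt_subproof d t).

Lemma der_l3_h (d0 : cdo G0) (d1 : cdo Gm1) l (h : {additive gamma Gm1 -> R}) :
  is_der0 d0 d1 l -> forall u v w,
  h (l u (l2 v w)) + h (l2m u (l v w))
      + h (l3 (d0 u) v w) + h (l3 u (d0 v) w) + h (l3 u v (d0 w))
    = h (d1 (l3 u v w)) + h (l (l2 u v) w) + h (l v (l2 u w))
      - h (l2m w (l u v)) + h (l2m v (l u w)).
Proof.
by move=> dD u v w; have := congr1 h (der_l3 dD u v w); rewrite !raddfD raddfN.
Qed.

Lemma der_l3_op1 (d0 t0 : cdo G0) (d1 t1 : cdo Gm1) l k
    (h : {additive gamma Gm1 -> R}) :
  is_der0 d0 d1 l -> is_der0 t0 t1 k -> forall u v w,
  h (t1 (l u (l2 v w)))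
      + (h (l2m (t0 u) (l v w)) + h (l2m u (t1 (l v w))) + h (k u (l1 (l v w))))
      + h (t1 (l3 (d0 u) v w)) + h (t1 (l3 u (d0 v) w)) + h (t1 (l3 u v (d0 w)))
    = h (t1 (d1 (l3 u v w))) + h (t1 (l (l2 u v) w)) + h (t1 (l v (l2 u w)))
      - (h (l2m (t0 w) (l u v)) + h (l2m w (t1 (l u v))) + h (k w (l1 (l u v))))
      + (h (l2m (t0 v) (l u w)) + h (l2m v (t1 (l u w))) + h (k v (l1 (l u w)))).
Proof.
move=> dD tD u v w; have := congr1 (fun x => h (t1 x)) (der_l3 dD u v w).
rewrite !raddfD !raddfN /= !(der_l2m tD) ?raddfD ?raddfN /=.
by rewrite ?raddfD ?opprD.
Qed.

Lemma der_br_subproof d t : der0_pred (der_br0 d t, der_br1 d t, der_br_alt d t).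
Proof.
have dD := der0P d; have tD := der0P t.
have E0 u : der_br0 d t u =
  der_op0 d (der_op0 t u) - der_op0 t (der_op0 d u) by [].
have E1 m : der_br1 d t m =
  der_op1 d (der_op1 t m) - der_op1 t (der_op1 d m) by [].
have E2 u v : der_br_alt d t u v =
  der_op1 d (der_alt t u v) - der_alt t (der_op0 d u) v
  - der_alt t u (der_op0 d v) + der_alt d (der_op0 t u) v
  + der_alt d u (der_op0 t v) - der_op1 t (der_alt d u v) by [].
apply/asboolP; split=> /= [|m|u v|u m|u v w].
- apply/val_inj; rewrite /= /symbol /= -!/(symbol _).
  by rewrite (der_symbol dD) (der_symbol tD).
- rewrite E0 E1 !(der_l1 dD, der_l1 tD); by push.
- rewrite !E0 ?E2 !(der_l2 dD, der_l2 tD); apply: gamma_sepP => h.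
  push; rewrite !(der_l2 dD, der_l2 tD, der_l1 dD, der_l1 tD); push; ring.
- rewrite E0 !E1 ?E2 !(der_l2m dD, der_l2m tD); apply: gamma_sepP => h.
  push; rewrite !(der_l2m dD, der_l2m tD) !(der_l1 dD, der_l1 tD); push; ring.
- rewrite !E0 !E1 ?E2; apply: gamma_sepP => h.
  have D1 := der_l3_op1 h dD tD u v w.
  have D2 := der_l3_h h dD (der_op0 t u) v w.
  have D3 := der_l3_h h dD u (der_op0 t v) w.
  have D4 := der_l3_h h dD u v (der_op0 t w).
  have T1 := der_l3_op1 h tD dD u v w.
  have T2 := der_l3_h h tD (der_op0 d u) v w.
  have T3 := der_l3_h h tD u (der_op0 d v) w.
  have T4 := der_l3_h h tD u v (der_op0 d w).
  rewrite !(der_l2 dD, der_l2 tD) !addlE !raddfD !raddfN /=.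
  rewrite ![der_alt _ (l1 _) _]alt_skew; push.
  lra.
Qed.
Definition der_br d t : der0 := Der0 (der_br_subproof d t).

(* The bracket [d, phi]_Der. *)
Lemma der_hom_linear (d : der0) (phi : hom G0 Gm1) :
  linear (fun u => der_op1 d (phi u) - phi (der_op0 d u)).
Proof.
move=> a u v; apply: gamma_sepP => h.
push; rewrite !linearZ !cdo_leibniz; push.
by rewrite !linearZ (der_symbol (der0P d)); push; ring.
Qed.
Definition der_hom d phi : hom G0 Gm1 := mk_hom (der_hom_linear d phi).

End Derivations.

(* P is the module of sections of a vector bundle over M. This does not hold
   automatically for der0 G: the rank of the degree 0 derivations may jump. *)
Definition is_bundle (R : realType) (M : manifold R) (P : lmodType (cinf M)) :
    Prop :=
  exists (E : vbundle M) (iota : {linear gamma E -> P}), bijective iota.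

(* Sections of a graded bundle A_{-n} + ... + A_0, where A i is the module of
   sections of the component of degree -i. *)
Section GradedSections.
Context {R : realType} {M : manifold R} {n : nat}.
Variable A : 'I_n.+1 -> lmodType (cinf M).

Definition gsec := forall i, A i.
HB.instance Definition _ := Choice.copy gsec (forall i, A i).

Implicit Types s t u : gsec.

Let gadd s t : gsec := fun i => s i + t i.
Let gopp s : gsec := fun i => - s i.
Let gzero : gsec := fun i => 0.
Let gscale (f : cinf M) s : gsec := fun i => f *: s i.

Let gaddA : associative gadd.
Proof. by move=> s t u; apply/functional_extensionality_dep => i; exact: addrA. Qed.
Let gaddC : commutative gadd.
Proof. by move=> s t; apply/functional_extensionality_dep => i; exact: addrC. Qed.
Let gadd0 : left_id gzero gadd.
Proof. by move=> s; apply/functional_extensionality_dep => i; exact: add0r. Qed.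
Let gaddN : left_inverse gzero gopp gadd.
Proof. by move=> s; apply/functional_extensionality_dep => i; exact: addNr. Qed.

HB.instance Definition _ :=
  GRing.isZmodule.Build gsec gaddA gaddC gadd0 gaddN.

Let gscaleA f g s : gscale f (gscale g s) = gscale (f * g) s.
Proof. by apply/functional_extensionality_dep => i; exact: scalerA. Qed.
Let gscale1 : left_id 1 gscale.
Proof. by move=> s; apply/functional_extensionality_dep => i; exact: scale1r. Qed.
Let gscaleDr : right_distributive gscale +%R.
Proof. by move=> f s t; apply/functional_extensionality_dep => i; exact: scalerDr. Qed.
Let gscaleDl s : {morph gscale^~ s : f g / f + g}.
Proof. by move=> f g; apply/functional_extensionality_dep => i; exact: scalerDl. Qed.

HB.instance Definition _ := GRing.Zmodule_isLmodule.Build (cinf M) gsec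
  gscaleA gscale1 gscaleDr gscaleDl.

(* x is homogeneous of degree -k; for n < k this means x = 0. *)
Definition homog (k : nat) (x : gsec) : Prop :=
  forall i : 'I_n.+1, (i : nat) != k -> x i = 0.

(* Strict Lie n.+1-algebroids; only the degrees -n, ..., 0 occur, so all signs
   depend on the parity of the index. *)
Record is_strict_lie_algebroid (rho : A ord0 -> vfield M) (d : gsec -> gsec)
    (br : gsec -> gsec -> gsec) : Prop := IsStrictLieAlgebroid {
  sla_bundle : forall i, is_bundle (A i);
  sla_anchor : linear rho;
  sla_d_linear : linear d;
  sla_d_deg : forall k x, homog k.+1 x -> homog k (d x);
  sla_d_deg0 : forall x, homog 0 x -> d x = 0;
  sla_br_linearl : forall (a : R) x x' y,
    br (cinf_cst a *: x + x') y = cinf_cst a *: br x y + br x' y;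
  sla_br_linearr : forall (a : R) x y y',
    br x (cinf_cst a *: y + y') = cinf_cst a *: br x y + br x y';
  sla_br_deg : forall j k x y, homog j x -> homog k y -> homog (j + k) (br x y);
  sla_br_skew : forall j k x y, homog j x -> homog k y ->
    br x y = - ((-1) ^+ (j * k) *: br y x);
  sla_d_d : forall x, d (d x) = 0;
  sla_d_br : forall j k x y, homog j x -> homog k y ->
    d (br x y) = br (d x) y + (-1) ^+ j *: br x (d y);
  sla_jacobi : forall j k l x y z, homog j x -> homog k y -> homog l z ->
    br x (br y z) = br (br x y) z + (-1) ^+ (j * k) *: br y (br x z);
  sla_leibniz : forall (f : cinf M) x y, homog 0 x ->
    br x (f *: y) = f *: br x y + (rho (x ord0) f : cinf M) *: y }.

End GradedSections.

Section DER.
Context {R : realType} {M : manifold R}.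
Variable G : lie2 M.
Notation C := (cinf M).
Notation G0 := (G0 G).
Notation Gm1 := (Gm1 G).

(* The component of degree -k of DER(G). *)
Definition DER_comp (k : nat) : lmodType C :=
  match k with
  | 0 => der0 G
  | 1 => (hom G0 Gm1 * gamma G0)%type
  | _ => gamma Gm1
  end.

Definition DER (i : 'I_3) : lmodType C := DER_comp i.

Definition DER_mk (a : der0 G) (b : hom G0 Gm1 * gamma G0) (c : gamma Gm1) :
    gsec DER :=
  fun i => match nat_of_ord i as k return DER_comp k with
           | 0 => a
           | 1 => b
           | _ => c
           end.

Definition DER_0 (x : gsec DER) : der0 G := x (@Ordinal 3 0 isT).
Definition DER_1 (x : gsec DER) : hom G0 Gm1 * gamma G0 := x (@Ordinal 3 1 isT).
Definition DER_2 (x : gsec DER) : gamma Gm1 := x (@Ordinal 3 2 isT).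

(* - l2(m, .), which maps u to l2(u, m). *)
Definition l2_hom (m : gamma Gm1) : hom G0 Gm1 := mk_hom (@l2m_linearl _ _ G m).

Definition DER_d (x : gsec DER) : gsec DER :=
  DER_mk (delta (DER_1 x).1 + ad (DER_1 x).2)
         (l2_hom (DER_2 x), l1 G (DER_2 x))
         0.

(* The bracket [d, phi + u]. *)
Definition DER_act (d : der0 G) (p : hom G0 Gm1 * gamma G0) :
    hom G0 Gm1 * gamma G0 :=
  (der_hom d p.1 + mk_hom (alt_linear (der_alt d) p.2), der_op0 d p.2).

(* By graded skew-symmetry [x, d] = - [d, x] for d of degree 0. *)
Definition DER_br (x y : gsec DER) : gsec DER :=
  DER_mk (der_br (DER_0 x) (DER_0 y))
         (DER_act (DER_0 x) (DER_1 y) - DER_act (DER_0 y) (DER_1 x))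
         (der_op1 (DER_0 x) (DER_2 y) - der_op1 (DER_0 y) (DER_2 x)
          + ((DER_1 x).1 (DER_1 y).2 + (DER_1 y).1 (DER_1 x).2)).

Definition DER_anchor (d : DER ord0) : vfield M := anchor (d : der0 G).

End DER.

(* Main.v *)
From HB Require Import structures.
From Pilot Require Import Defs.
From mathcomp Require Import all_boot all_order all_algebra.
From mathcomp Require Import all_classical all_reals all_analysis.
From mathcomp Require Import ring lra.
Import Pilot.Defs.

(** There are two independent things to see: the identities of a differential
    graded Lie algebra with anchor hold, and each homogeneous component is the
    module of sections of a vector bundle.

    The identities. Everything is assembled from four operations: the bracket
    [der_br] of degree 0 derivations, the action [DER_act] of a derivation d on
    pairs phi + u, the action [der_op1] on degree -2, and the symmetric pairing
    [DER_pair] that brackets two pairs into degree -2; the differential has the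
    components [DER_d1] and [DER_d2]. The Jacobi identity says that [der_br] is
    a Lie bracket ([der_br_jacobi]), that the two actions are representations
    of it ([DER_act_br]; for [der_op1] this is the definition of the bracket)
    and that the pairing is equivariant ([DER_act_pair]). The Leibniz rule
    for d says that [DER_d1] and [DER_d2] are equivariant ([der_br_d1],
    [DER_act_d2]) and that d is a derivation of the pairing ([DER_act_d1],
    [op1_d1]); d squares to zero because of [DER_d1_d2]. The defining equations
    of a degree 0 derivation are what makes d equivariant, and the axioms
    of the Lie 2-algebra are what makes it a derivation of the pairing and of
    square zero. No other combination of degrees contributes, since a bracket of
    degree below -2 vanishes ([homog_ge3]).

    The bundles. In degree 0 this is the hypothesis, and in degree -2 there is
    nothing to do. In degree -1 the module is the product of the
    module of function-linear maps between sections and a module of sections, so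
    besides direct sums ([is_bundle_prod]) one needs the tensoriality theorem
    ([is_bundle_hom]): a map of sections that is linear over smooth functions is
    given by a smooth section of the bundle of fibrewise linear maps. Its proof
    rests on bump functions ([bump_function]), which extend local frames to
    global sections and show that the value of the image at a point depends
    only on the value of the section there ([hom_eval0]). Bump functions are
    products of one-variable functions built from exp(-1/t), whose smoothness
    follows because the family t^-m exp(-1/t), extended by 0 to t <= 0, is closed
    under differentiation up to linear combinations ([is_derive_flat_exp]). *)

Set Implicit Arguments.
Unset Strict Implicit.
Unset Printing Implicit Defensive.

Import Order.TTheory GRing.Theory Num.Theory.
Import numFieldNormedType.Exports.
Local Open Scope classical_set_scope.
Local Open Scope ring_scope.

(** * Flat functions and smoothness on Euclidean space *)

Section FlatExp.
Context {R : realType}.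

(** The power t^-m makes the family stable under differentiation, so that
    all derivatives of exp(-1/t) are treated at once. *)
Definition flat_exp (m : nat) (t : R) : R :=
  if 0 < t then t ^- m * expR (- t^-1) else 0.

Lemma flat_exp_le0 m t : t <= 0 -> flat_exp m t = 0.
Proof. by move=> t0; rewrite /flat_exp ltNge t0. Qed.

Lemma flat_exp0_gt0 t : 0 < t -> 0 < flat_exp 0 t.
Proof. by move=> t0; rewrite /flat_exp t0 expr0 invr1 mul1r expR_gt0. Qed.

(** Keeping a single term of the exponential series of 1/t bounds exp(-1/t) by
    (m+2)! t^(m+2). A quadratic bound is what differentiability at 0 needs. *)
Lemma flat_exp_bound m t :
  `|flat_exp m t| <= (m.+2)`!%:R * `|t| ^+ 2.
Proof.
rewrite /flat_exp; case: ifP => t0; last by rewrite normr0 mulr_ge0.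
rewrite !gtr0_norm ?mulr_gt0 ?expR_gt0 ?invr_gt0 ?exprn_gt0//.
have F : 0 < ((m.+2)`!%:R : R) by rewrite ltr0n fact_gt0.
have E : t^-1 ^+ m.+2 / (m.+2)`!%:R <= expR t^-1.
  have := @expR_ge1Dxn R t^-1 m.+1; rewrite invr_ge0 (ltW t0) => /(_ isT).
  by apply: le_trans; rewrite lerDr.
rewrite expRN ler_pdivrMr ?expR_gt0//.
have -> : t ^- m = (m.+2)`!%:R * t ^+ 2 * (t^-1 ^+ m.+2 / (m.+2)`!%:R).
  rewrite -[m.+2]addn2 exprD !exprVn; field.
  by rewrite addn2 gt_eqF ?F// gt_eqF//= gt_eqF ?exprn_gt0.
by rewrite ler_pM2l // mulr_gt0// exprn_gt0.
Qed.

Lemma is_derive_inv (t : R) : t != 0 -> is_derive t 1 (fun s : R => s^-1) (- t ^- 2).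
Proof.
move=> t0; have di : derivable (id : R -> R) t 1 by [].
apply: DeriveDef; first exact: (@derivableV _ _ (id : R -> R)).
by rewrite (@deriveV _ _ (id : R -> R)) ?derive_id//; exact: mulr1.
Qed.

(** The only point where a computation does not suffice is t = 0; there the
    difference quotient is at most a multiple of |t| by [flat_exp_bound]. *)
Lemma is_derive_flat_exp m (t : R) :
  is_derive t 1 (flat_exp m) (- m%:R * flat_exp m.+1 t + flat_exp m.+2 t).
Proof.
have [t0|t0|t0] := ltgtP 0 t.
- have tn0 : t != 0 by rewrite gt_eqF.
  have near_E : \forall s \near t,
      (((fun s : R => s^-1) ^+ m) * (expR \o (- (fun s : R => s^-1)))) s = flat_exp m s.
    near=> s; rewrite /flat_exp ifT; last by near: s; exact: lt_nbhsr.
    by rewrite !fctE exprVn.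
  apply: near_eq_is_derive near_E _.
  have di := is_derive_inv tn0.
  have de := is_derive1_comp (is_derive_expR _) (is_deriveN di).
  apply: is_derive_eq (is_deriveM (is_deriveX m di) de) _.
  rewrite /flat_exp t0 !fctE.
  case: m => [|m] /=.
    rewrite !expr0 mul0r scale0r scaler0 addr0 oppr0 mul0r add0r opprK scale1r.
    by rewrite mulrC.
  rewrite opprK -![_ *: _]/(_ * _) -!exprVn !exprS; ring.
- have near_E : \forall s \near t, cst 0 s = flat_exp m s.
    near=> s; rewrite flat_exp_le0//; apply: ltW; near: s; exact: lt_nbhsl.
  apply: near_eq_is_derive near_E _.
  by rewrite !flat_exp_le0 ?(ltW t0)// mulr0 addr0; exact: is_derive_cst.
- rewrite -t0 !flat_exp_le0// mulr0 addr0.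
  set k := (m.+2)`!%:R : R.
  have k0 : 0 < k by rewrite ltr0n fact_gt0.
  have lim0 : h^-1 *: ((flat_exp m \o shift 0) (h *: 1) - flat_exp m 0)
      @[h --> 0^'] --> (0 : R).
    apply/cvgr0Pnorm_lt => e e0; near=> h.
    rewrite /= addr0 [flat_exp m 0]flat_exp_le0// subr0 -[_ *: 1]/(h * 1) mulr1 normrZ.
    have h0 : h != 0 by near: h; exact: nbhs_dnbhs_neq.
    apply: le_lt_trans (_ : k * `|h| < e).
      rewrite normfV ler_pdivrMl ?normr_gt0// mulrCA -expr2.
      exact: flat_exp_bound.
    rewrite -ltr_pdivlMl//; near: h.
    apply: dnbhs0_lt; by rewrite mulr_gt0 ?invr_gt0.
  apply: DeriveDef; first by apply/cvg_ex; exists 0.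
  exact: cvg_lim lim0.
Unshelve. all: by end_near. Qed.

End FlatExp.

Section Smooth.
Context {R : realType} {n : nat}.
Implicit Types (U : set 'rV[R]_n) (f g : 'rV[R]_n -> R).

(** Differentiability is required pointwise at each order, so smoothness can be
    checked on any cover, open or not. *)
Lemma ndiff_cover k U f :
  (forall x, U x -> exists2 V : set 'rV[R]_n, V x & ndiff k V f) -> ndiff k U f.
Proof.
elim: k f => [//|k IH] f H; split=> [x /H[V Vx [+ _]]|v]; first exact.
by apply: IH => x /H[V Vx [_ /(_ v) ?]]; exists V.
Qed.

Lemma derive_comp1 (phi : R -> R) (dphi : R) f (x v : 'rV[R]_n) :
  differentiable f x -> is_derive (f x) 1 phi dphi ->
  'D_v (phi \o f) x = dphi * 'D_v f x.
Proof.
move=> df [/derivable1_diffP dphi_ <-].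
rewrite deriveE; last exact: differentiable_comp.
rewrite diff_comp//= (deriveE v df) (deriveE (1 : R) dphi_) -[X in 'd _ _ X = _]mulr1.
by rewrite [LHS]linearZ mulrC.
Qed.

(** The induction on the order runs over all m simultaneously: by the chain rule
    a derivative brings in the exponents m+1 and m+2. *)
Lemma ndiff_flat_exp k m U f : open U -> ndiff k U f ->
  ndiff k U (flat_exp m \o f).
Proof.
move=> oU; elim: k m f => [//|k IH] m f Hf0; have [df Hf] := Hf0; split.
  move=> x Ux; apply: differentiable_comp; first exact: df.
  by apply/derivable1_diffP; have [] := is_derive_flat_exp m (f x).
move=> v; have Hf' := ndiffW Hf0.
have Hphi := ndiffD oU (ndiffM oU (ndiff_cst k U (- m%:R)) (IH m.+1 f Hf'))
  (IH m.+2 f Hf').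
apply: ndiff_ext (ndiffM oU Hphi (Hf v)) => // x Ux.
by rewrite (derive_comp1 v (df x Ux) (is_derive_flat_exp m (f x))).
Qed.

Lemma ndiffV k U f : open U -> (forall x, U x -> f x != 0) -> ndiff k U f ->
  ndiff k U (fun x => (f x)^-1).
Proof.
move=> oU f0; elim: k f f0 => [//|k IH] f f0 Hf0; have [df Hf] := Hf0; split.
  by move=> x Ux; apply: differentiableV; [exact: df|exact: f0].
move=> v; have HV := IH f f0 (ndiffW Hf0).
apply: ndiff_ext (ndiffM oU (ndiff_cst k U (-1))
  (ndiffM oU (ndiffM oU HV HV) (Hf v))) => // x Ux.
rewrite deriveV ?f0//; last exact: diff_derivable (df x Ux).
by rewrite -exprVn -[RHS]/(_ * _) /=; ring.
Qed.

End Smooth.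

(** * Smooth functions and bump functions on a manifold *)

Section SmoothManifold.
Context {R : realType} {M : manifold R}.
Implicit Types (W V : set M) (f g : M -> R).

Lemma smooth_fun_cover W f :
  (forall x, W x -> exists V, V x /\ smooth_fun V f) -> smooth_fun W f.
Proof.
move=> H c cM k; apply: ndiff_cover => _ [x [cx Wx] <-].
have [V [Vx sf]] := H x Wx.
by exists (chart_map c @` (chart_dom c `&` V)); [exists x|exact: sf].
Qed.

Lemma smooth_fun_ext W f g : open W -> (forall x, W x -> f x = g x) ->
  smooth_fun W f -> smooth_fun W g.
Proof.
move=> oW fg sf c cM k; have oI := chart_im_openI cM oW.
apply: ndiff_ext (sf c cM k) => // _ [x [cx Wx] <-] /=.
by rewrite (chart_mapK (mchart cM)) ?inE// fg.
Qed.

Lemma smooth_fun_flat_exp W f m : open W -> smooth_fun W f ->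
  smooth_fun W (fun x => flat_exp m (f x)).
Proof.
move=> oW sf c cM k; have oI := chart_im_openI cM oW.
exact: ndiff_flat_exp oI (sf c cM k).
Qed.

Lemma smooth_funV W f : open W -> (forall x, W x -> f x != 0) ->
  smooth_fun W f -> smooth_fun W (fun x => (f x)^-1).
Proof.
move=> oW f0 sf c cM k; have oI := chart_im_openI cM oW.
apply: (ndiffV oI) (sf c cM k) => _ [x [cx Wx] <-] /=.
by rewrite (chart_mapK (mchart cM)) ?inE//; exact: f0.
Qed.

Lemma smooth_fun_sum W (I : Type) (r : seq I) (F : I -> M -> R) : open W ->
  (forall i, smooth_fun W (F i)) -> smooth_fun W (fun x => \sum_(i <- r) F i x).
Proof.
move=> oW sF; elim: r => [|i r IH].
  by under eq_fun do rewrite big_nil; exact: smooth_fun_cst.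
by under eq_fun do rewrite big_cons; exact: smooth_funD.
Qed.

Lemma smooth_fun_prod W (I : Type) (r : seq I) (F : I -> M -> R) : open W ->
  (forall i, smooth_fun W (F i)) -> smooth_fun W (fun x => \prod_(i <- r) F i x).
Proof.
move=> oW sF; elim: r => [|i r IH].
  by under eq_fun do rewrite big_nil; exact: smooth_fun_cst.
by under eq_fun do rewrite big_cons; exact: smooth_funM.
Qed.

(** In other charts, the coordinates of [c] are the transition maps of the atlas. *)
Lemma smooth_fun_coord (c : chart R M (mdim M)) i : matlas c ->
  smooth_fun (chart_dom c) (fun x => chart_map c x 0 i).
Proof. by move=> cM c' c'M; exact: mcompat c'M cM i. Qed.

(** In a chart at [x0], the function is a product over the coordinates of
    exp(-1/(r^2 - (y_i - a_i)^2)), cut off outside a cube of half-side r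
    around the image [a] of [x0]. The preimage K of the closed cube is compact,
    hence closed as M is Hausdorff; this is what makes the extension by 0
    smooth at points outside of the chart. *)
Lemma bump_function W (x0 : M) : open W -> W x0 ->
  exists (chi : cinf M) (K : set M),
    [/\ closed K, K `<=` W, chi x0 = 1 & forall x, ~ K x -> chi x = 0].
Proof.
move=> oW Wx0; have [c cM cx0] := mcover x0; have cc := mchart cM.
pose a := chart_map c x0.
have [e /= e0 aW] : exists2 e : R, 0 < e &
    ball a e `<=` chart_map c @` (chart_dom c `&` W).
  apply/nbhs_ballP; have := chart_im_openI cM oW; rewrite openE; apply.
  by exists x0.
pose r := e / 2; have r0 : 0 < r by rewrite divr_gt0.
pose S := [set y : 'rV[R]_(mdim M) |
  forall i, `[a 0 i - r, a 0 i + r]%classic (y ord0 i)].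
have SW : S `<=` chart_map c @` (chart_dom c `&` W).
  move=> y Sy; apply: aW; split=> // i j; rewrite (ord1 i).
  have := Sy j; rewrite /= in_itv/= -ler_distlC /ball/= => /le_lt_trans; apply.
  by rewrite /r ltr_pdivrMr// ltr_pMr// ltr1n.
pose K := chart_inv c @` S.
have KW : K `<=` chart_dom c `&` W.
  by move=> _ [y /SW[x [cx Wx] <-] <-]; rewrite (chart_mapK cc) ?inE.
have cK : closed K.
  apply: compact_closed; first exact: mhausdorff.
  apply: continuous_compact.
    apply: continuous_in_subspaceT => y; rewrite inE => /SW[x [cx _] <-].
    by apply: (chart_inv_cont cc); exists x.
  apply: (@rV_compact R _ (fun i => `[a 0 i - r, a 0 i + r]%classic)) => i.
  exact: segment_compact.
pose f (x : M) := \prod_i flat_exp 0 (r ^+ 2 - (chart_map c x 0 i - a 0 i) ^+ 2).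
pose g x := if x \in chart_dom c then f x else 0.
have sf : smooth_fun (chart_dom c) f.
  have oc := chart_dom_open cc.
  apply: smooth_fun_prod => // i; apply: smooth_fun_flat_exp => //.
  have sd : smooth_fun (chart_dom c) (fun x => chart_map c x 0 i + cst (- a 0 i) x).
    apply: smooth_funD => //; first exact: smooth_fun_coord.
    exact: smooth_fun_cst.
  have sm := smooth_funM oc (smooth_fun_cst _ (-1)) (smooth_funM oc sd sd).
  apply: smooth_fun_ext (smooth_funD oc (smooth_fun_cst _ (r ^+ 2)) sm) => // x _ /=.
  by ring.
have gK x : ~ K x -> g x = 0.
  move=> Kx; rewrite /g; case: ifPn => // /set_mem cx.
  have /existsNP[i Hi] : ~ S (chart_map c x).
    by move=> Sx; apply: Kx; exists (chart_map c x); rewrite ?(chart_mapK cc) ?inE.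
  rewrite /f (bigD1 i)//= flat_exp_le0 ?mul0r// subr_le0.
  move: Hi; rewrite /= in_itv/= -ler_distlC => /negP; rewrite -ltNge distrC => Hi.
  by rewrite -[leRHS]real_normK ?num_real// lerXn2r ?nnegrE ?(ltW r0)// ltW.
have sg : smooth_fun setT g.
  apply: smooth_fun_cover => x _; have [cx|cx] := pselect (chart_dom c x).
    exists (chart_dom c); split=> //; apply: smooth_fun_ext sf.
      exact: chart_dom_open cc.
    by move=> y cy; rewrite /g ifT ?inE.
  exists (~` K); split=> [/KW[]//|].
  apply: smooth_fun_ext (smooth_fun_cst _ 0); first exact: closed_openC.
  by move=> y /gK.
have gx0 : 0 < g x0.
  rewrite /g ifT ?inE// prodr_gt0// => i _; rewrite flat_exp0_gt0//.
  by rewrite subrr expr0n subr0 exprn_gt0.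
have h : cinf_pred (fun x => cst (g x0)^-1 x * g x).
  by apply/asboolP; apply: smooth_funM => //; [exact: openT|exact: smooth_fun_cst].
exists (CInf h), K; split=> //=; first by move=> x /KW[].
- by rewrite mulVf// gt_eqF.
- by move=> x /gK ->; rewrite mulr0.
Qed.

Lemma smooth_fun_continuous W (f : M -> R) x : open W -> W x -> smooth_fun W f ->
  {for x, continuous f}.
Proof.
move=> oW Wx sf; have [c cM cx] := mcover x; have cc := mchart cM.
have [df _] := sf c cM 1%N.
have fc : {for chart_map c x, continuous (f \o chart_inv c)}.
  by apply/differentiable_continuous/df; exists x.
have near_f : \forall y \near x, (f \o chart_inv c) (chart_map c y) = f y.
  have := chart_dom_open cc; rewrite openE => /(_ x cx); apply: filterS => y cy /=.
  by rewrite (chart_mapK cc) ?inE.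
have E : f y @[y --> x] --> (f \o chart_inv c) (chart_map c x).
  apply: cvg_trans (near_eq_cvg near_f) _.
  exact: (cvg_comp _ _ (chart_map_cont cc cx) fc).
by move: E; rewrite (nbhs_singleton near_f).
Qed.

Lemma cinf_neq0_open (f : cinf M) : open [set x | f x != 0].
Proof.
apply: (@open_comp _ _ f [set r | r != 0]); last exact: open_neq.
by move=> x _; exact: smooth_fun_continuous openT I (cinf_smooth f).
Qed.

End SmoothManifold.

(** * Local frames and tensoriality *)

Section LocalFrames.
Context {R : realType} {M : manifold R}.
Implicit Types E F : vbundle M.

Lemma gamma_eq E (s t : gamma E) : (forall x, gamma_val s x = gamma_val t x) -> s = t.
Proof. by move=> st; apply/val_inj/functional_extensionality_dep. Qed.

Section Triv.
Context {B : M -> vectType R} (t : triv B) (ht : is_triv t).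

Lemma tr_map_inj x : tr_dom t x -> injective (tr_map t x).
Proof. by move=> tx; exact: can_inj (tr_mapK ht tx). Qed.

Lemma tr_inv_row x (A : 'rV_(tr_rank t)) : tr_dom t x ->
  tr_inv t x A = \sum_i A 0 i *: tr_inv t x (delta_mx 0 i).
Proof.
move=> tx; apply: (tr_map_inj tx); rewrite (tr_invK ht tx) linear_sum /=.
rewrite [LHS]row_sum_delta; apply: eq_bigr => i _.
by rewrite linearZ /= (tr_invK ht tx).
Qed.

Lemma tr_expand x v : tr_dom t x ->
  v = \sum_i tr_map t x v 0 i *: tr_inv t x (delta_mx 0 i).
Proof. by move=> tx; rewrite -tr_inv_row// (tr_mapK ht tx). Qed.

Lemma tr_inv0 x : tr_dom t x -> tr_inv t x 0 = 0.
Proof. by move=> tx; rewrite -(linear0 (tr_map t x)) (tr_mapK ht tx). Qed.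

End Triv.

(** Transition functions are smooth, so one trivialization near each point is
    enough, and it may be restricted to a smaller open set. *)
Lemma smooth_section_local E (s : presection E) :
  (forall x, exists t V, [/\ vb_atlas t, open V, V x, V `<=` tr_dom t &
    forall i, smooth_fun V (fun y => tr_map t y (s y) 0 i)]) ->
  smooth_section s.
Proof.
move=> H t' t'E j; apply: smooth_fun_cover => x t'x.
have [t [V [tE oV Vx Vt sV]]] := H x.
have ot' := tr_dom_open (vb_triv t'E); have ht := vb_triv tE.
have oVt' : open (V `&` tr_dom t') by exact: openI.
exists (V `&` tr_dom t'); split=> //.
have := @smooth_fun_sum R M _ _ (index_enum 'I_(tr_rank t)) (fun i y =>
  tr_map t y (s y) 0 i * tr_map t' y (tr_inv t y (delta_mx 0 i)) 0 j) oVt'.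
move=> sS; apply: smooth_fun_ext (sS _) => // [y [Vy _]|i] /=.
  rewrite [in RHS](tr_expand ht (s y) (Vt y Vy)) linear_sum summxE.
  by apply: eq_bigr => i _; rewrite linearZ mxE.
apply: smooth_funM => //.
  by apply: smooth_funS (sV i) => y [].
by apply: smooth_funS (vb_compat tE t'E i j) => y [/Vt].
Qed.

Section Cutoff.
Variables (chi : cinf M) (K : set M).
Hypotheses (cK : closed K) (chiK : forall x, ~ K x -> chi x = 0).

Lemma cutoff_section E (t : triv (vb_fibre E)) (s : presection E) : vb_atlas t ->
  K `<=` tr_dom t ->
  (forall i, smooth_fun (tr_dom t) (fun x => tr_map t x (s x) 0 i)) ->
  exists e : gamma E, forall x, gamma_val e x = chi x *: s x.
Proof.
move=> tE Kt ss.
suff sm : section_pred (fun x => chi x *: s x : vb_fibre E x) by exists (Gamma sm).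
apply/asboolP; apply: smooth_section_local => x.
have ot := tr_dom_open (vb_triv tE).
have [tx|tx] := pselect (tr_dom t x).
  exists t, (tr_dom t); split=> // i.
  under eq_fun do rewrite linearZ mxE.
  apply: smooth_funM => //; exact: smooth_funS (cinf_smooth chi).
have [t' t'E t'x] := vb_cover E x.
have oV : open (~` K `&` tr_dom t').
  by apply: openI; [exact: closed_openC|exact: tr_dom_open (vb_triv t'E)].
exists t', (~` K `&` tr_dom t'); split=> // [|i]; first by split=> // /Kt.
apply: smooth_fun_ext (smooth_fun_cst _ 0) => // y [Ky _].
by rewrite chiK// scale0r linear0 mxE.
Qed.

Lemma cutoff_fun W (f : M -> R) : open W -> K `<=` W -> smooth_fun W f ->
  exists g : cinf M, forall x, g x = chi x * f x.
Proof.
move=> oW KW sf.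
suff sm : cinf_pred (fun x => chi x * f x) by exists (CInf sm).
apply/asboolP; apply: smooth_fun_cover => x _.
have [Wx|Wx] := pselect (W x).
  exists W; split=> //; apply: smooth_funM => //.
  exact: smooth_funS (cinf_smooth chi).
exists (~` K); split; first by move/KW.
apply: smooth_fun_ext (smooth_fun_cst _ 0); first exact: closed_openC.
by move=> y Ky; rewrite chiK// mul0r.
Qed.

End Cutoff.

(** The section with constant coordinates in a trivialization, cut off by a bump
    function that is 1 at [x]. *)
Lemma section_through E x (v : vb_fibre E x) : exists e : gamma E, gamma_val e x = v.
Proof.
have [t tE tx] := vb_cover E x; have ht := vb_triv tE.
have [chi [K [cK Kt chix chiK]]] := bump_function (tr_dom_open ht) tx.
have [|e eE] := cutoff_section (s := fun y => tr_inv t y (tr_map t x v)) cK chiK tE Kt.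
  move=> i; apply: smooth_fun_ext (smooth_fun_cst _ (tr_map t x v 0 i)).
    exact: tr_dom_open ht.
  by move=> y ty; rewrite (tr_invK ht ty).
by exists e; rewrite eE chix scale1r (tr_mapK ht tx).
Qed.

(** The cut-off frame is a frame only where [chi] does not vanish, in
    particular near [x]. *)
Lemma local_frame E (t : triv (vb_fibre E)) x : vb_atlas t -> tr_dom t x ->
  exists (chi : cinf M) (K : set M) (e : 'I_(tr_rank t) -> gamma E),
    [/\ closed K, K `<=` tr_dom t, chi x = 1, forall y, ~ K y -> chi y = 0 &
    forall i y, gamma_val (e i) y = chi y *: tr_inv t y (delta_mx 0 i)].
Proof.
move=> tE tx; have ht := vb_triv tE.
have [chi [K [cK Kt chix chiK]]] := bump_function (tr_dom_open ht) tx.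
have H i : exists e : gamma E, forall y,
    gamma_val e y = chi y *: tr_inv t y (delta_mx 0 i).
  apply: (cutoff_section cK chiK tE Kt) => j.
  apply: smooth_fun_ext (smooth_fun_cst _ ((delta_mx 0 i : 'rV_(tr_rank t)) 0 j)).
    exact: tr_dom_open ht.
  by move=> y ty; rewrite (tr_invK ht ty).
exists chi, K, (fun i => projT1 (cid (H i))); split=> // i y.
by case: cid => e /= ->.
Qed.

(** Tensoriality at a point. Multiplying [u] by the square of a bump function
    gives a combination of global sections [e i] with global coefficients [g i]:
    one factor extends the frame, the other one the coordinates of [u]. Then
    linearity over functions moves [h] past the coefficients, which vanish
    at [x] with [u]. *)
Lemma hom_eval0 E F (h : hom E F) (u : gamma E) x :
  gamma_val u x = 0 -> gamma_val (h u) x = 0.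
Proof.
move=> ux; have [t tE tx] := vb_cover E x; have ht := vb_triv tE.
have [chi [K [e [cK Kt chix chiK eE]]]] := local_frame tE tx.
have ot := tr_dom_open ht.
have H i : exists g : cinf M, forall y, g y = chi y * tr_map t y (gamma_val u y) 0 i.
  by apply: (cutoff_fun cK chiK ot Kt); exact: (asboolW (valP u)).
pose g i := projT1 (cid (H i)).
have gE i y : g i y = chi y * tr_map t y (gamma_val u y) 0 i by rewrite /g; case: cid.
have sumE (G : vbundle M) (s : 'I_(tr_rank t) -> gamma G) y :
    gamma_val (\sum_i g i *: s i) y = \sum_i g i y *: gamma_val (s i) y.
  by elim/big_rec2 : _ => // i a b _ <-.
have uE : (chi * chi) *: u = \sum_i g i *: e i.
  apply: gamma_eq => y; rewrite sumE.
  have [ty|ty] := pselect (tr_dom t y); last first.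
    have chi0 : chi y = 0 by apply: chiK => /Kt.
    rewrite -[LHS]/((chi y * chi y) *: gamma_val u y) chi0 mul0r scale0r big1// => i _.
    by rewrite gE chi0 mul0r scale0r.
  rewrite -[LHS]/((chi y * chi y) *: gamma_val u y).
  rewrite [in LHS](tr_expand ht (gamma_val u y) ty) scaler_sumr.
  by apply: eq_bigr => i _; rewrite gE eE !scalerA; congr (_ *: _); ring.
have := congr1 (fun s : gamma F => gamma_val s x) (congr1 h uE).
rewrite linearZ linear_sum /= -[LHS]/((chi x * chi x) *: gamma_val (h u) x).
rewrite chix mulr1 scale1r => ->.
have -> : \sum_i h (g i *: e i) = \sum_i g i *: h (e i).
  by apply: eq_bigr => i _; rewrite linearZ.
by rewrite sumE big1// => i _; rewrite gE ux linear0 mxE mulr0 scale0r.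
Qed.

Lemma hom_eval_eq E F (h : hom E F) (u v : gamma E) x :
  gamma_val u x = gamma_val v x -> gamma_val (h u) x = gamma_val (h v) x.
Proof.
move=> uv; apply/eqP; rewrite -subr_eq0.
rewrite -[_ - _]/(gamma_val (h u - h v) x) -linearB; apply/eqP/hom_eval0.
by rewrite -[LHS]/(gamma_val u x - gamma_val v x) uv subrr.
Qed.

End LocalFrames.

(** * Direct sums of vector bundles *)

Section SumBundle.
Context {R : realType} {M : manifold R}.
Variables E F : vbundle M.

Definition sum_fibre (x : M) : vectType R := (vb_fibre E x * vb_fibre F x)%type.

Section SumTriv.
Variables (t : triv (vb_fibre E)) (t' : triv (vb_fibre F)).

Definition sum_tr_map x (v : sum_fibre x) : 'rV[R]_(tr_rank t + tr_rank t') :=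
  row_mx (tr_map t x v.1) (tr_map t' x v.2).

Lemma sum_tr_map_linear x : linear (@sum_tr_map x).
Proof.
move=> a v w; rewrite /sum_tr_map -[(a *: v + w).1]/(a *: v.1 + w.1).
by rewrite -[(a *: v + w).2]/(a *: v.2 + w.2) !linearP scale_row_mx add_row_mx.
Qed.
HB.instance Definition _ x := GRing.isLinear.Build R (sum_fibre x)
  'rV[R]_(tr_rank t + tr_rank t') _ (@sum_tr_map x) (@sum_tr_map_linear x).

Definition sum_triv : triv sum_fibre := {|
  tr_dom := tr_dom t `&` tr_dom t';
  tr_rank := tr_rank t + tr_rank t';
  tr_map := fun x => @sum_tr_map x;
  tr_inv := fun x A => (tr_inv t x (lsubmx A), tr_inv t' x (rsubmx A)) |}.

Lemma sum_is_triv : is_triv t -> is_triv t' -> is_triv sum_triv.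
Proof.
move=> ht ht'; split=> [|x [tx tx'] v|x [tx tx'] A] /=.
- by apply: openI; exact: tr_dom_open.
- rewrite /sum_tr_map row_mxKl row_mxKr (tr_mapK ht tx) (tr_mapK ht' tx').
  by case: v.
- by rewrite /sum_tr_map /= (tr_invK ht tx) (tr_invK ht' tx') hsubmxK.
Qed.

End SumTriv.

Definition sum_atlas : set (triv sum_fibre) :=
  [set s | exists t t', [/\ vb_atlas t, vb_atlas t' & s = sum_triv t t']].

Lemma sum_atlas_triv s : sum_atlas s -> is_triv s.
Proof. by move=> [t [t' [tE tF ->]]]; apply: sum_is_triv; exact: vb_triv. Qed.

Lemma sum_atlas_cover x : exists2 s, sum_atlas s & tr_dom s x.
Proof.
have [[t tE tx] [t' tF tx']] := (vb_cover E x, vb_cover F x).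
by exists (sum_triv t t') => //; exists t, t'.
Qed.

Lemma sum_atlas_compat s s' : sum_atlas s -> sum_atlas s' -> triv_compat s s'.
Proof.
move=> [t1 [t1' [t1E t1F ->]]] [t2 [t2' [t2E t2F ->]]] /= i j.
have [h1 h1'] := (vb_triv t1E, vb_triv t1F).
have [dt1 ot1' ot2 ot2'] : [/\ open (tr_dom t1), open (tr_dom t1'),
    open (tr_dom t2) & open (tr_dom t2')].
  by split; apply: tr_dom_open; exact: vb_triv.
have oV := openI (openI dt1 ot1') (openI ot2 ot2').
case: (split_ordP i) => {}i ->; case: (split_ordP j) => {}j ->.
- apply: (smooth_fun_ext oV) (smooth_funS _ (vb_compat t1E t2E i j)) => /=.
    move=> x _; rewrite /sum_tr_map row_mxEl; congr (tr_map _ _ (tr_inv _ _ _) _ _).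
    by apply/rowP => k; rewrite !mxE (inj_eq (@lshift_inj _ _)).
  by move=> x [[? ?] [? ?]].
- apply: (smooth_fun_ext oV) (smooth_fun_cst _ 0) => x [[? ?] _].
  rewrite /= /sum_tr_map row_mxEr /= [rsubmx _](_ : _ = 0).
    by rewrite (tr_inv0 h1')// linear0 mxE.
  by apply/rowP => k; rewrite !mxE eq_rlshift.
- apply: (smooth_fun_ext oV) (smooth_fun_cst _ 0) => x [[? ?] _].
  rewrite /= /sum_tr_map row_mxEl /= [lsubmx _](_ : _ = 0).
    by rewrite (tr_inv0 h1)// linear0 mxE.
  by apply/rowP => k; rewrite !mxE eq_lrshift.
- apply: (smooth_fun_ext oV) (smooth_funS _ (vb_compat t1F t2F i j)) => /=.
    move=> x _; rewrite /sum_tr_map row_mxEr; congr (tr_map _ _ (tr_inv _ _ _) _ _).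
    by apply/rowP => k; rewrite !mxE (inj_eq (@rshift_inj _ _)).
  by move=> x [[? ?] [? ?]].
Qed.

Definition sum_bundle : vbundle M := {|
  vb_fibre := sum_fibre;
  vb_atlas := sum_atlas;
  vb_triv := sum_atlas_triv;
  vb_cover := sum_atlas_cover;
  vb_compat := sum_atlas_compat |}.

Lemma sum_section_fst (s : gamma sum_bundle) :
  section_pred (fun x => (gamma_val s x).1 : vb_fibre E x).
Proof.
apply/asboolP; apply: smooth_section_local => x.
have [[t tE tx] [t' tF tx']] := (vb_cover E x, vb_cover F x).
exists t, (tr_dom t `&` tr_dom t'); split=> //.
  by apply: openI; apply: tr_dom_open; exact: vb_triv.
move=> i; have sA : sum_atlas (sum_triv t t') by exists t, t'.
have := asboolW (valP s) _ sA (lshift _ i).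
apply: smooth_fun_ext => [|y _] /=; last by rewrite row_mxEl.
exact: tr_dom_open (sum_atlas_triv sA).
Qed.

Lemma sum_section_snd (s : gamma sum_bundle) :
  section_pred (fun x => (gamma_val s x).2 : vb_fibre F x).
Proof.
apply/asboolP; apply: smooth_section_local => x.
have [[t tE tx] [t' tF tx']] := (vb_cover E x, vb_cover F x).
exists t', (tr_dom t `&` tr_dom t'); split=> //.
  by apply: openI; apply: tr_dom_open; exact: vb_triv.
move=> i; have sA : sum_atlas (sum_triv t t') by exists t, t'.
have := asboolW (valP s) _ sA (rshift _ i).
apply: smooth_fun_ext => [|y _] /=; last by rewrite row_mxEr.
exact: tr_dom_open (sum_atlas_triv sA).
Qed.

Lemma sum_section_pair (s : gamma E * gamma F) :
  section_pred ((fun x => (gamma_val s.1 x, gamma_val s.2 x)) : presection sum_bundle).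
Proof.
apply/asboolP => _ [t [t' [tE tF ->]]] i /=.
have oV : open (tr_dom t `&` tr_dom t').
  by apply: openI; apply: tr_dom_open; exact: vb_triv.
case: (split_ordP i) => {}i ->.
  have := asboolW (valP s.1) _ tE i => /(smooth_funS (@subIsetl _ _ (tr_dom t'))).
  by apply: smooth_fun_ext => // y _; rewrite /sum_tr_map row_mxEl.
have := asboolW (valP s.2) _ tF i => /(smooth_funS (@subIsetr _ (tr_dom t) _)).
by apply: smooth_fun_ext => // y _; rewrite /sum_tr_map row_mxEr.
Qed.

Definition sum_section (s : gamma sum_bundle) : gamma E * gamma F :=
  (Gamma (sum_section_fst s), Gamma (sum_section_snd s)).

Lemma sum_section_linear : linear sum_section.
Proof. by move=> f s t; apply: injective_projections; apply: gamma_eq. Qed.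
HB.instance Definition _ := GRing.isLinear.Build (cinf M) (gamma sum_bundle)
  (gamma E * gamma F)%type _ sum_section sum_section_linear.

Lemma sum_section_bij : bijective sum_section.
Proof.
exists (fun s => Gamma (sum_section_pair s)) => s.
  by apply: gamma_eq => x /=; case: (gamma_val s x).
by apply: injective_projections; apply: gamma_eq.
Qed.

End SumBundle.

Lemma is_bundle_gamma (R : realType) (M : manifold R) (E : vbundle M) :
  is_bundle (gamma E).
Proof. by exists E, idfun; exists idfun. Qed.

Lemma is_bundle_prod (R : realType) (M : manifold R)
    (P Q : lmodType (cinf M)) :
  is_bundle P -> is_bundle Q -> is_bundle (P * Q)%type.
Proof.
move=> [E [i bi]] [F [j bj]].
have [i' iK i'K] := bi; have [j' jK j'K] := bj.
pose f (s : gamma (sum_bundle E F)) := (i (sum_section s).1, j (sum_section s).2).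
have lf : linear f.
  by move=> a s t; rewrite /f linearP /= !linearP.
pose fL := GRing.isLinear.Build _ _ _ _ f lf.
pose f' : {linear _ -> _} := HB.pack f fL.
have [g gK g'K] := sum_section_bij E F.
exists (sum_bundle E F), f', (fun p => g (i' p.1, j' p.2)) => [s|[p q]] /=.
  by rewrite iK jK -[RHS]gK; congr g; case: sum_section.
by rewrite /f g'K i'K j'K.
Qed.

(** * The bundle of fibrewise linear maps *)

Section HomBundle.
Context {R : realType} {M : manifold R}.
Variables E F : vbundle M.

Definition hom_fibre (x : M) : vectType R := 'Hom(vb_fibre E x, vb_fibre F x).

Section HomTriv.
Variables (t : triv (vb_fibre E)) (t' : triv (vb_fibre F)).
Notation r := (tr_rank t).
Notation r' := (tr_rank t').

Definition hom_tr_map x (h : hom_fibre x) : 'rV[R]_(r * r') :=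
  mxvec (\matrix_i tr_map t' x (h (tr_inv t x (delta_mx 0 i)))).

Lemma hom_tr_map_linear x : linear (@hom_tr_map x).
Proof.
move=> a h k; rewrite /hom_tr_map -linearP; congr mxvec.
by apply/matrixP => i j; rewrite !mxE add_lfunE scale_lfunE linearP !mxE.
Qed.
HB.instance Definition _ x := GRing.isLinear.Build R (hom_fibre x)
  'rV[R]_(r * r') _ (@hom_tr_map x) (@hom_tr_map_linear x).

Definition hom_tr_fun x (A : 'rV[R]_(r * r')) (v : vb_fibre E x) : vb_fibre F x :=
  \sum_i tr_map t x v 0 i *: tr_inv t' x (row i (vec_mx A)).

Lemma hom_tr_fun_linear x A : linear (@hom_tr_fun x A).
Proof.
move=> a v w; rewrite /hom_tr_fun scaler_sumr -big_split /=.
by apply: eq_bigr => i _; rewrite linearP !mxE scalerDl scalerA.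
Qed.
HB.instance Definition _ x A := GRing.isLinear.Build R (vb_fibre E x)
  (vb_fibre F x) _ (@hom_tr_fun x A) (@hom_tr_fun_linear x A).

Definition hom_triv : triv hom_fibre := {|
  tr_dom := tr_dom t `&` tr_dom t';
  tr_rank := r * r';
  tr_map := fun x => @hom_tr_map x;
  tr_inv := fun x A => linfun (@hom_tr_fun x A) |}.

Lemma hom_tr_fun_frame x A i : is_triv t -> tr_dom t x ->
  hom_tr_fun A (tr_inv t x (delta_mx 0 i)) = tr_inv t' x (row i (vec_mx A)).
Proof.
move=> ht tx; rewrite /hom_tr_fun (bigD1 i)//= (tr_invK ht tx) mxE !eqxx scale1r.
by rewrite big1 ?addr0// => k /negPf ki; rewrite mxE ki andbF scale0r.
Qed.

Lemma hom_is_triv : is_triv t -> is_triv t' -> is_triv hom_triv.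
Proof.
move=> ht ht'; split=> [|x [tx tx'] h|x [tx tx'] A] /=.
- by apply: openI; exact: tr_dom_open.
- apply/lfunP => v; rewrite lfunE /= /hom_tr_fun [in RHS](tr_expand ht v tx).
  rewrite linear_sum; apply: eq_bigr => i _; rewrite linearZ /=; congr (_ *: _).
  by rewrite /hom_tr_map mxvecK rowK (tr_mapK ht' tx').
- rewrite /hom_tr_map -[RHS]vec_mxK; congr mxvec; apply/row_matrixP => i.
  by rewrite rowK lfunE /= hom_tr_fun_frame// (tr_invK ht' tx').
Qed.

End HomTriv.

Definition hom_atlas : set (triv hom_fibre) :=
  [set s | exists t t', [/\ vb_atlas t, vb_atlas t' & s = hom_triv t t']].

Lemma hom_atlas_triv s : hom_atlas s -> is_triv s.
Proof. by move=> [t [t' [tE tF ->]]]; apply: hom_is_triv; exact: vb_triv. Qed.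

Lemma hom_atlas_cover x : exists2 s, hom_atlas s & tr_dom s x.
Proof.
have [[t tE tx] [t' tF tx']] := (vb_cover E x, vb_cover F x).
by exists (hom_triv t t') => //; exists t, t'.
Qed.

(** In the bases of elementary matrices, a transition function is the product of
    a transition function of E, taken backwards, and one of F. *)
Lemma hom_atlas_compat s s' : hom_atlas s -> hom_atlas s' -> triv_compat s s'.
Proof.
move=> sA s'A; have hs := hom_atlas_triv sA; have hs' := hom_atlas_triv s'A.
have oV := openI (tr_dom_open hs) (tr_dom_open hs').
move: sA s'A oV {hs hs'}.
move=> [t1 [t1' [t1E t1F ->]]] [t2 [t2' [t2E t2F ->]]] /= oV i j.
case/mxvec_indexP: i => a b; case/mxvec_indexP: j => c d.
have sc := smooth_funM oV
  (smooth_funS _ (vb_compat t2E t1E c a)) (smooth_funS _ (vb_compat t1F t2F b d)).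
apply: (smooth_fun_ext oV) (sc _ _) => [x [[tx tx'] _]|x [[? ?] [? ?]]//|];
  last by move=> x [[? ?] [? ?]].
rewrite /= /hom_tr_map mxvecE mxE lfunE /= /hom_tr_fun vec_mx_delta.
rewrite (bigD1 a)//= [X in _ + X]big1 => [|k /negPf ka].
  rewrite addr0 linearZ mxE; congr (_ * tr_map _ _ (tr_inv _ _ _) _ _).
  by apply/rowP => k; rewrite !mxE !eqxx.
rewrite [row _ _](_ : _ = 0) ?(tr_inv0 (vb_triv t1F))// ?scaler0//.
by apply/rowP => l; rewrite !mxE ka.
Qed.

Definition hom_bundle : vbundle M := {|
  vb_fibre := hom_fibre;
  vb_atlas := hom_atlas;
  vb_triv := hom_atlas_triv;
  vb_cover := hom_atlas_cover;
  vb_compat := hom_atlas_compat |}.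

Lemma hom_section_apply (s : gamma hom_bundle) (u : gamma E) :
  section_pred ((fun x => (gamma_val s x : hom_fibre x) (gamma_val u x))
    : presection F).
Proof.
apply/asboolP; apply: smooth_section_local => x.
have [[t tE tx] [t' tF tx']] := (vb_cover E x, vb_cover F x).
have sA : hom_atlas (hom_triv t t') by exists t, t'.
have oV := tr_dom_open (hom_atlas_triv sA).
exists t', (tr_dom t `&` tr_dom t'); split=> // j.
have ss := smooth_fun_sum (index_enum 'I_(tr_rank t)) oV (fun i => smooth_funM oV
  (smooth_funS (@subIsetl _ _ _) (asboolW (valP u) _ tE i))
  (asboolW (valP s) _ sA (mxvec_index i j))).
apply: (smooth_fun_ext oV) ss => y [ty _] /=.
rewrite [in RHS](tr_expand (vb_triv tE) (gamma_val u y) ty) !linear_sum summxE.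
by apply: eq_bigr => i _; rewrite !linearZ mxE /hom_tr_map mxvecE mxE.
Qed.

Definition hom_section_fun (s : gamma hom_bundle) (u : gamma E) : gamma F :=
  Gamma (hom_section_apply s u).

Lemma hom_section_fun_linear s : linear (hom_section_fun s).
Proof. by move=> f u v; apply: gamma_eq => x /=; exact: linearP. Qed.

Definition hom_section (s : gamma hom_bundle) : hom E F :=
  mk_hom (hom_section_fun_linear s).

Lemma hom_section_linear : linear hom_section.
Proof.
move=> f s t; apply/val_inj/funext => u; apply: gamma_eq => x /=.
by rewrite -[LHS]/((f x *: gamma_val s x + gamma_val t x : hom_fibre x) (gamma_val u x))
  add_lfunE scale_lfunE.
Qed.
HB.instance Definition _ := GRing.isLinear.Build (cinf M) (gamma hom_bundle)
  (hom E F) _ hom_section hom_section_linear.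

(** A choice of section through each vector; by tensoriality, the choice does
    not affect what is computed from it below. *)
Definition extend x (v : vb_fibre E x) : gamma E := projT1 (cid (section_through v)).

Lemma extendE x (v : vb_fibre E x) : gamma_val (extend v) x = v.
Proof. by rewrite /extend; case: cid. Qed.

Section Pointwise.
Variable h : hom E F.

Definition hom_at x (v : vb_fibre E x) : vb_fibre F x := gamma_val (h (extend v)) x.

Lemma hom_atE (u : gamma E) x : hom_at (gamma_val u x) = gamma_val (h u) x.
Proof. by apply: hom_eval_eq; rewrite extendE. Qed.

Lemma hom_at_linear x : linear (@hom_at x).
Proof.
move=> a v w; have -> : a *: v + w = gamma_val (cinf_cst a *: extend v + extend w) x.
  by rewrite -[RHS]/(a *: gamma_val (extend v) x + gamma_val (extend w) x) !extendE.
by rewrite hom_atE linearP.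
Qed.
HB.instance Definition _ x := GRing.isLinear.Build R (vb_fibre E x)
  (vb_fibre F x) _ (@hom_at x) (@hom_at_linear x).

(** The matrix entries of [hom_at] are the coordinates of the images of a frame.
    Only the frame cut off by [chi] consists of global sections, so one divides by
    [chi] where it does not vanish. *)
Lemma hom_at_section :
  section_pred ((fun x => linfun (@hom_at x)) : presection hom_bundle).
Proof.
apply/asboolP; apply: smooth_section_local => x.
have [[t tE tx] [t' tF tx']] := (vb_cover E x, vb_cover F x).
have sA : hom_atlas (hom_triv t t') by exists t, t'.
have [chi [K [e [cK Kt chix chiK eE]]]] := local_frame tE tx.
pose V := (tr_dom t `&` tr_dom t') `&` [set y | chi y != 0].
have oV : open V.
  by apply: openI (cinf_neq0_open chi); exact: tr_dom_open (hom_atlas_triv sA).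
exists (hom_triv t t'), V; split=> //.
- by split=> //=; rewrite chix oner_neq0.
- exact: subIsetl.
move=> i; case/mxvec_indexP: i => a b.
have sV : smooth_fun V (fun y => (chi y)^-1).
  apply: smooth_funV => //; first by move=> y [].
  exact: smooth_funS (cinf_smooth chi).
have sh : smooth_fun V (fun y => tr_map t' y (gamma_val (h (e a)) y) 0 b).
  by apply: smooth_funS (asboolW (valP (h (e a))) _ tF b) => y [[]].
apply: (smooth_fun_ext oV) (smooth_funM oV sV sh) => y [_ /= chi0].
rewrite /hom_tr_map mxvecE mxE lfunE /= -hom_atE eE !linearZ mxE mulrA mulVf//.
by rewrite mul1r.
Qed.

End Pointwise.

Lemma hom_section_bij : bijective hom_section.
Proof.
exists (fun h => Gamma (hom_at_section h)) => [s|h].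
  apply: gamma_eq => x /=; apply/lfunP => v; rewrite lfunE /= /hom_at /=.
  by rewrite extendE.
apply/val_inj/funext => u; apply: gamma_eq => x /=.
by rewrite lfunE /= hom_atE.
Qed.

(** Evaluation of a section of the bundle of linear maps on sections is inverted
    by [hom_at], thanks to [hom_atE]. *)
Lemma is_bundle_hom : is_bundle (hom E F).
Proof. by exists hom_bundle, hom_section; exact: hom_section_bij. Qed.

End HomBundle.

(** * The algebra of derivations *)

Section DerivationAlgebra.
Context {R : realType} {M : manifold R}.
Variable G : lie2 M.
Notation C := (cinf M).
Notation G0 := (G0 G).
Notation Gm1 := (Gm1 G).
Notation l1 := (l1 G).
Notation l2 := (l2 G).
Notation l2m := (l2m G).
Notation l3 := (l3 G).
Implicit Types (d t s : der0 G) (phi psi : hom G0 Gm1).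
Implicit Types (u v w : gamma G0) (m n : gamma Gm1).

Lemma cdoD (E : vbundle M) (D : cdo E) x y : D (x + y) = D x + D y.
Proof. exact: raddfD. Qed.
Lemma cdoN (E : vbundle M) (D : cdo E) x : D (- x) = - D x.
Proof. exact: raddfN. Qed.
Lemma homDr (E F : vbundle M) (h : hom E F) x y : h (x + y) = h x + h y.
Proof. exact: linearD. Qed.
Lemma homNr (E F : vbundle M) (h : hom E F) x : h (- x) = - h x.
Proof. exact: linearN. Qed.
Lemma homZr (E F : vbundle M) (h : hom E F) a x : h (a *: x) = a *: h x.
Proof. exact: linearZ. Qed.
Lemma altDr (E F : vbundle M) (b : alt E F) e x y : b e (x + y) = b e x + b e y.
Proof. exact: linearD. Qed.
Lemma altNr (E F : vbundle M) (b : alt E F) e x : b e (- x) = - b e x.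
Proof. exact: linearN. Qed.
Lemma altZr (E F : vbundle M) (b : alt E F) e a x : b e (a *: x) = a *: b e x.
Proof. exact: linearZ. Qed.
Lemma l1D m n : l1 (m + n) = l1 m + l1 n. Proof. exact: linearD. Qed.
Lemma l1N m : l1 (- m) = - l1 m. Proof. exact: linearN. Qed.
Lemma l1Z a m : l1 (a *: m) = a *: l1 m. Proof. exact: linearZ. Qed.
Lemma l2Dr u v w : l2 u (v + w) = l2 u v + l2 u w. Proof. exact: linearD. Qed.
Lemma l2Nr u v : l2 u (- v) = - l2 u v. Proof. exact: linearN. Qed.
Lemma l2Zr u a v : l2 u (a *: v) = a *: l2 u v. Proof. exact: linearZ. Qed.
Lemma l2mDr u m n : l2m u (m + n) = l2m u m + l2m u n. Proof. exact: linearD. Qed.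
Lemma l2mNr u m : l2m u (- m) = - l2m u m. Proof. exact: linearN. Qed.
Lemma l2mZr u a m : l2m u (a *: m) = a *: l2m u m. Proof. exact: linearZ. Qed.

Definition distrE := (cdoD, cdoN, homDr, homNr, homZr, altDr, altNr, altZr,
  l1D, l1N, l1Z, l2Dr, l2Nr, l2Zr, l2mDr, l2mNr, l2mZr, @addlE R M,
  @scalelE R M, @opprK).
Definition scaleE := (@scalerDr, @scalerDl, @scalerN, @scaleNr).

Local Ltac push := rewrite ?distrE;
  match goal with h : {additive _ -> _} |- _ => rewrite ?(raddfD h, raddfN h) end.
Local Ltac expand := rewrite ?distrE ?scaleE;
  match goal with h : {additive _ -> _} |- _ => rewrite ?(raddfD h, raddfN h) end.

Lemma cdo_eq (E : vbundle M) (D D' : cdo E) :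
  (forall e, D e = D' e) -> symbol D = symbol D' -> D = D'.
Proof.
move=> eD eS; apply/val_inj/injective_projections => //=.
exact/funext.
Qed.

Lemma hom_eq (E F : vbundle M) (h k : hom E F) : (forall e, h e = k e) -> h = k.
Proof. by move=> hk; apply/val_inj/funext. Qed.

Lemma der0_eq d t : (forall u, der_op0 d u = der_op0 t u) ->
  (forall m, der_op1 d m = der_op1 t m) ->
  (forall u v, der_alt d u v = der_alt t u v) -> anchor d = anchor t -> d = t.
Proof.
move=> e0 e1 e2 ea; apply/val_inj/injective_projections; last first.
  by apply/val_inj/funext => u; apply/funext => v; exact: e2.
apply/injective_projections; apply: cdo_eq => //.
have := ea; rewrite /anchor (der_symbol (der0P d)) (der_symbol (der0P t)).
exact.
Qed.

Lemma op0D d t u : der_op0 (d + t) u = der_op0 d u + der_op0 t u. Proof. by []. Qed.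
Lemma op0N d u : der_op0 (- d) u = - der_op0 d u. Proof. by []. Qed.
Lemma op0Z a d u : der_op0 (a *: d) u = a *: der_op0 d u. Proof. by []. Qed.
Lemma op00 u : der_op0 (0 : der0 G) u = 0. Proof. by []. Qed.
Lemma op1D d t m : der_op1 (d + t) m = der_op1 d m + der_op1 t m. Proof. by []. Qed.
Lemma op1N d m : der_op1 (- d) m = - der_op1 d m. Proof. by []. Qed.
Lemma op1Z a d m : der_op1 (a *: d) m = a *: der_op1 d m. Proof. by []. Qed.
Lemma op10 m : der_op1 (0 : der0 G) m = 0. Proof. by []. Qed.
Lemma daltD d t u v : der_alt (d + t) u v = der_alt d u v + der_alt t u v.
Proof. by []. Qed.
Lemma daltN d u v : der_alt (- d) u v = - der_alt d u v. Proof. by []. Qed.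
Lemma daltZ a d u v : der_alt (a *: d) u v = a *: der_alt d u v. Proof. by []. Qed.
Lemma dalt0 u v : der_alt (0 : der0 G) u v = 0. Proof. by []. Qed.
Lemma homD phi psi u : (phi + psi) u = phi u + psi u. Proof. by []. Qed.
Lemma homN phi u : (- phi) u = - phi u. Proof. by []. Qed.
Lemma homZ a phi u : (a *: phi) u = a *: phi u. Proof. by []. Qed.
Lemma hom0 u : (0 : hom G0 Gm1) u = 0. Proof. by []. Qed.

Lemma op0_delta phi u : der_op0 (delta phi) u = l1 (phi u). Proof. by []. Qed.
Lemma op0_ad u v : der_op0 (ad u) v = l2 u v. Proof. by []. Qed.
Lemma op0_br d t u : der_op0 (der_br d t) u =
  der_op0 d (der_op0 t u) - der_op0 t (der_op0 d u). Proof. by []. Qed.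
Lemma op1_delta phi m : der_op1 (delta phi) m = phi (l1 m). Proof. by []. Qed.
Lemma op1_ad u m : der_op1 (ad u) m = l2m u m. Proof. by []. Qed.
Lemma op1_br d t m : der_op1 (der_br d t) m =
  der_op1 d (der_op1 t m) - der_op1 t (der_op1 d m). Proof. by []. Qed.
Lemma dalt_delta phi u v : der_alt (delta phi) u v =
  phi (l2 u v) + l2m v (phi u) - l2m u (phi v). Proof. by []. Qed.
Lemma dalt_ad u v w : der_alt (ad u) v w = l3 u v w. Proof. by []. Qed.
Lemma dalt_br d t u v : der_alt (der_br d t) u v =
  der_op1 d (der_alt t u v) - der_alt t (der_op0 d u) v
  - der_alt t u (der_op0 d v) + der_alt d (der_op0 t u) v
  + der_alt d u (der_op0 t v) - der_op1 t (der_alt d u v). Proof. by []. Qed.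
Lemma der_homE d phi u : der_hom d phi u = der_op1 d (phi u) - phi (der_op0 d u).
Proof. by []. Qed.
Lemma l2_homE m u : l2_hom m u = l2m u m. Proof. by []. Qed.
Lemma mk_homE (f : gamma G0 -> gamma Gm1) (lf : linear f) u : mk_hom lf u = f u.
Proof. by []. Qed.

Definition opE := (op0D, op0N, op0Z, op00, op1D, op1N, op1Z, op10,
  daltD, daltN, daltZ, dalt0, homD, homN, homZ, hom0,
  op0_delta, op0_ad, op0_br, op1_delta, op1_ad, op1_br,
  dalt_delta, dalt_ad, dalt_br, der_homE, l2_homE, mk_homE).

Lemma vfield_eq (X Y : vfield M) : (forall f : C, X f = Y f :> C) -> X = Y.
Proof. by move=> XY; apply/val_inj/funext. Qed.

Lemma anchor_br d t : anchor (der_br d t) = vbr (anchor d) (anchor t).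
Proof. by []. Qed.
Lemma anchor_delta phi : anchor (delta phi) = 0. Proof. by []. Qed.
Lemma anchor_ad u : anchor (ad u) = 0. Proof. by []. Qed.
Lemma anchorD d t : anchor (d + t) = anchor d + anchor t. Proof. by []. Qed.
Lemma anchorZ a d : anchor (a *: d) = a *: anchor d. Proof. by []. Qed.
Lemma anchorN d : anchor (- d) = - anchor d. Proof. by []. Qed.
Lemma vbrE (X Y : vfield M) (f : C) : vbr X Y f = (X (Y f : C) : C) - Y (X f : C) :> C.
Proof. by []. Qed.
Lemma vfieldD (X Y : vfield M) (f : C) : (X + Y) f = (X f : C) + Y f :> C.
Proof. by []. Qed.
Lemma vfieldN (X : vfield M) (f : C) : (- X) f = - (X f : C) :> C. Proof. by []. Qed.
Lemma vfieldZ a (X : vfield M) (f : C) : (a *: X) f = a * (X f : C) :> C.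
Proof. by []. Qed.
Lemma vfield0 (f : C) : (0 : vfield M) f = 0 :> C. Proof. by []. Qed.
Lemma vbrv0 (X : vfield M) : vbr X 0 = 0.
Proof. by apply: vfield_eq => f; rewrite vbrE !vfield0 raddf0 subrr. Qed.

Lemma delta_linear : linear (@delta R M G).
Proof.
move=> a phi psi; apply: der0_eq => [u|m|u v|]; rewrite ?opE //.
- by rewrite linearP.
- apply: gamma_sepP => h; expand; ring.
- by rewrite anchorD anchorZ !anchor_delta scaler0 addr0.
Qed.

Lemma ad_linear : linear (@ad R M G).
Proof.
move=> a u u'; apply: der0_eq => [v|m|v w|]; rewrite ?opE //.
- by rewrite addlE scalelE.
- by rewrite addlE scalelE.
- by rewrite addlE scalelE.
- by rewrite anchorD anchorZ !anchor_ad scaler0 addr0.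
Qed.

(** On G0 this is the compatibility of l1 with l2m, on Gm1 the relation
    [l2m_l1], and for alternating parts the Jacobi identity [l3_l1], which
    computes l3 with one argument in the image of l1. *)
Lemma delta_l2_hom m : delta (l2_hom m) + ad (l1 m) = 0.
Proof.
apply: der0_eq => [u|n|u v|]; rewrite ?opE //.
- by rewrite l1_l2m [l2 (l1 m) u]l2_skew subrr.
- by rewrite l2m_l1 addNr.
- rewrite (l3_skew12 (l1 m)) (l3_skew23 u) l3_l1 opprK.
  by apply: gamma_sepP => h; rewrite raddf0; push; ring.
- by rewrite anchorD anchor_delta anchor_ad addr0.
Qed.

Lemma der_br_skew d t : der_br d t = - der_br t d.
Proof.
apply: der0_eq => [u|n|u v|]; rewrite ?opE ?opprB //.
  apply: gamma_sepP => h; push; ring.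
rewrite anchorN !anchor_br; apply: vfield_eq => f.
by rewrite vfieldN !vbrE opprB.
Qed.

(** Formal for the commutators, and also on alternating parts: there the bracket
    is d.l_t - t.l_d, for the action of derivations on 2-forms on G0 with values
    in Gm1 through their operators on G0 and Gm1. *)
Lemma der_br_jacobi d t s :
  der_br d (der_br t s) = der_br (der_br d t) s + der_br t (der_br d s).
Proof.
apply: der0_eq => [u|n|u v|]; rewrite ?opE.
- apply: gamma_sepP => h; push; ring.
- apply: gamma_sepP => h; push; ring.
- apply: gamma_sepP => h; push; ring.
- rewrite anchorD !anchor_br; apply: vfield_eq => f.
  rewrite vfieldD !vbrE !raddfB /=; ring.
Qed.

(** Compatibility of d with l2m enters twice, once for each summand of
    the alternating part of delta phi; the correction terms cancel the action of
    the alternating part of d on the image of l1. *)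
Lemma der_br_delta d phi : der_br d (delta phi) = delta (der_hom d phi).
Proof.
have dD := der0P d.
apply: der0_eq => [u|m|u v|]; rewrite ?opE.
- by rewrite (der_l1 dD) linearB.
- by rewrite (der_l1 dD).
- rewrite (der_l2 dD); apply: gamma_sepP => h; push; rewrite !(der_l2m dD); push.
  rewrite (alt_skew (der_alt d) (l1 _)); push; ring.
- by rewrite anchor_br !anchor_delta vbrv0.
Qed.

(** The failure of d to be a strict derivation of l2 is the delta-exact term;
    on alternating parts this is the compatibility of d with l3. *)
Lemma der_br_ad d u : der_br d (ad u) =
  delta (mk_hom (alt_linear (der_alt d) u)) + ad (der_op0 d u).
Proof.
have dD := der0P d.
apply: der0_eq => [v|m|v w|]; rewrite ?opE.
- by rewrite (der_l2 dD); apply: gamma_sepP => h; push; ring.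
- by rewrite (der_l2m dD); apply: gamma_sepP => h; push; ring.
- apply: gamma_sepP => h; have := der_l3_h h dD u v w; push; lra.
- by rewrite anchorD anchor_br anchor_delta anchor_ad vbrv0 addr0.
Qed.

Lemma der_br_linearr (a : R) d t s : der_br d (cinf_cst a *: t + s) =
  cinf_cst a *: der_br d t + der_br d s.
Proof.
apply: der0_eq => [u|m|u v|]; rewrite ?opE ?cdo_linear.
- by apply: gamma_sepP => h; expand; ring.
- by apply: gamma_sepP => h; expand; ring.
- by apply: gamma_sepP => h; expand; ring.
- rewrite !anchorD !anchorZ !anchor_br !anchorD !anchorZ; apply: vfield_eq => f.
  by rewrite !(vfieldD, vfieldZ, vbrE) (vfieldP _).1; ring.
Qed.

Lemma der_br_leibniz d (f : C) t :
  der_br d (f *: t) = f *: der_br d t + (anchor d f : C) *: t.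
Proof.
apply: der0_eq => [u|m|u v|]; rewrite ?opE ?cdo_leibniz.
- by apply: gamma_sepP => h; expand; ring.
- rewrite -(der_symbol (der0P d)).
  by apply: gamma_sepP => h; expand; ring.
- rewrite -(der_symbol (der0P d)).
  by apply: gamma_sepP => h; expand; ring.
- rewrite !anchorD !anchorZ !anchor_br !anchorZ; apply: vfield_eq => g.
  by rewrite !(vfieldD, vfieldZ, vbrE) (vfieldP _).2; ring.
Qed.

(** The bracket of two elements of degree -1. *)
Definition DER_pair (p q : hom G0 Gm1 * gamma G0) : gamma Gm1 :=
  p.1 q.2 + q.1 p.2.

(** The components of the differential on degrees -1 and -2. *)
Definition DER_d1 (p : hom G0 Gm1 * gamma G0) : der0 G := delta p.1 + ad p.2.

Definition DER_d2 (m : gamma Gm1) : hom G0 Gm1 * gamma G0 := (l2_hom m, l1 m).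

Implicit Types (p q : hom G0 Gm1 * gamma G0).

Lemma DER_act1 d p u : (DER_act d p).1 u = der_op1 d (p.1 u) - p.1 (der_op0 d u) +
  der_alt d p.2 u.
Proof. by []. Qed.
Lemma DER_act2 d p : (DER_act d p).2 = der_op0 d p.2. Proof. by []. Qed.
Lemma pairD p q : p + q = (p.1 + q.1, p.2 + q.2). Proof. by []. Qed.
Lemma pairN p : - p = (- p.1, - p.2). Proof. by []. Qed.
Lemma pairZ a p : a *: p = (a *: p.1, a *: p.2). Proof. by []. Qed.
Definition pairE := (DER_act1, DER_act2, pairD, pairN, pairZ).

Lemma DER_act_br d t p : DER_act (der_br d t) p =
  DER_act d (DER_act t p) - DER_act t (DER_act d p).
Proof.
apply: injective_projections; rewrite ?pairE; last by [].
by apply: hom_eq => u; rewrite ?pairE ?opE; apply: gamma_sepP => h; push; ring.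
Qed.

(** The terms in the alternating part of d cancel by skew-symmetry, because the
    pairing is symmetric. *)
Lemma DER_act_pair d p q :
  der_op1 d (DER_pair p q) = DER_pair (DER_act d p) q + DER_pair p (DER_act d q).
Proof.
rewrite /DER_pair ?pairE (alt_skew _ q.2).
by apply: gamma_sepP => h; push; ring.
Qed.

Lemma DER_act_linearr (a : R) d p q : DER_act d (cinf_cst a *: p + q) =
  cinf_cst a *: DER_act d p + DER_act d q.
Proof.
apply: injective_projections; rewrite ?pairE; last by rewrite cdo_linear.
apply: hom_eq => u; rewrite ?pairE ?opE cdo_linear altDl altZl.
by apply: gamma_sepP => h; expand; ring.
Qed.

Lemma DER_act_linearl a d t p :
  DER_act (a *: d + t) p = a *: DER_act d p + DER_act t p.
Proof.
apply: injective_projections; rewrite ?pairE; last by [].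
apply: hom_eq => u; rewrite ?pairE ?opE linearD linearZ /=.
by apply: gamma_sepP => h; expand; ring.
Qed.

Lemma DER_act_leibniz d (f : C) p :
  DER_act d (f *: p) = f *: DER_act d p + (anchor d f : C) *: p.
Proof.
apply: injective_projections; rewrite ?pairE; last by rewrite cdo_leibniz.
apply: hom_eq => u; rewrite ?pairE ?opE cdo_leibniz altZl -(der_symbol (der0P d)).
by apply: gamma_sepP => h; expand; ring.
Qed.

Lemma DER_pair_linear a p q q' :
  DER_pair p (a *: q + q') = a *: DER_pair p q + DER_pair p q'.
Proof.
rewrite /DER_pair ?pairE ?opE homDr homZr.
by apply: gamma_sepP => h; expand; ring.
Qed.

Lemma DER_pairC p q : DER_pair p q = DER_pair q p.
Proof. by rewrite /DER_pair addrC. Qed.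

Lemma DER_d1_linear : linear DER_d1.
Proof.
by move=> a p q; rewrite /DER_d1 /= delta_linear ad_linear scalerDr addrACA.
Qed.

Lemma DER_d2_linear : linear DER_d2.
Proof.
move=> a m n; rewrite /DER_d2 linearP; apply: injective_projections => //=.
by apply: hom_eq => u; rewrite ?pairE ?opE linearP.
Qed.

Lemma DER_d1_d2 m : DER_d1 (DER_d2 m) = 0.
Proof. exact: delta_l2_hom. Qed.

Lemma der_br_d1 d p : der_br d (DER_d1 p) = DER_d1 (DER_act d p).
Proof.
rewrite /DER_d1 -[delta p.1]scale1r -cinf_cst1 der_br_linearr cinf_cst1 scale1r.
rewrite der_br_delta der_br_ad /= -[der_hom d p.1]scale1r delta_linear.
by rewrite !scale1r addrA.
Qed.

Lemma DER_act_d2 d m : DER_act d (DER_d2 m) = DER_d2 (der_op1 d m).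
Proof.
have dD := der0P d; apply: injective_projections; rewrite ?pairE;
  last exact: der_l1 dD m.
apply: hom_eq => u; rewrite ?pairE ?opE (der_l2m dD) (alt_skew _ (l1 m)).
by apply: gamma_sepP => h; push; ring.
Qed.

(** The l3 terms cancel by skew-symmetry, and the values of phi and psi on brackets
    cancel between delta and the action of inner derivations; the terms with l2m
    acting on phi(v) and psi(u) are what is left. *)
Lemma DER_act_d1 p q :
  DER_act (DER_d1 p) q + DER_act (DER_d1 q) p = DER_d2 (DER_pair p q).
Proof.
apply: injective_projections; rewrite ?pairE.
  apply: hom_eq => u; rewrite ?pairE ?opE (l3_skew12 p.2).
  by apply: gamma_sepP => h; rewrite /DER_pair; push; ring.
rewrite ?pairE ?opE (l2_skew p.2) -[(DER_d2 _).2]/(l1 _) /DER_pair.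
by apply: gamma_sepP => h; push; ring.
Qed.

Lemma op1_d1 p m : der_op1 (DER_d1 p) m = DER_pair p (DER_d2 m).
Proof. by []. Qed.

End DerivationAlgebra.

(** * The graded Lie algebra and its bundles *)

Section Graded.
Context {R : realType} {M : manifold R}.
Variable G : lie2 M.
Notation C := (cinf M).
Notation A := (@DER R M G).
Implicit Types (x y z : gsec A) (d t : der0 G) (m n : gamma (Gm1 G)).
Implicit Types (p q : hom (G0 G) (Gm1 G) * gamma (G0 G)).

Lemma ord3_ind (P : 'I_3 -> Prop) : P (@Ordinal 3 0 isT) -> P (@Ordinal 3 1 isT) ->
  P (@Ordinal 3 2 isT) -> forall i, P i.
Proof.
by move=> P0 P1 P2 [[|[|[|//]]] lti]; rewrite (bool_irrelevance lti isT).
Qed.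

Lemma gsec_eq x y : DER_0 x = DER_0 y -> DER_1 x = DER_1 y -> DER_2 x = DER_2 y ->
  x = y.
Proof. by move=> *; apply/functional_extensionality_dep; apply: ord3_ind. Qed.

(** Homogeneous elements in a form on which brackets and differentials compute. *)
Lemma homogE k x : homog k x -> x = match k with
  | 0 => DER_mk (DER_0 x) 0 0
  | 1 => DER_mk 0 (DER_1 x) 0
  | 2 => DER_mk 0 0 (DER_2 x)
  | _ => 0
  end.
Proof.
have xi i (lti : (i < 3)%N) : homog k x -> i != k -> x (Ordinal lti) = 0.
  by move=> + ik; exact.
case: k xi => [|[|[|k]]] xi xk; apply: gsec_eq => //;
  first [exact: (xi 0%N isT xk isT) | exact: (xi 1%N isT xk isT) |
         exact: (xi 2%N isT xk isT)].
Qed.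

Lemma DER_mk_homog k a p m :
  (k != 0%N -> a = 0) -> (k != 1%N -> p = 0) -> (k != 2 -> m = 0) ->
  homog k (@DER_mk _ _ G a p m).
Proof. by move=> ka kp km; apply: ord3_ind => /=; rewrite eq_sym. Qed.

Lemma der_br0 d : der_br d 0 = 0.
Proof. by have := der_br_leibniz d 0 0; rewrite !scale0r scaler0 addr0. Qed.
Lemma der_0br d : der_br 0 d = 0.
Proof. by rewrite der_br_skew der_br0 oppr0. Qed.
Lemma DER_act0r d : DER_act d 0 = 0.
Proof. by have := DER_act_leibniz d 0 0; rewrite !scale0r scaler0 addr0. Qed.
Lemma DER_act0l p : DER_act 0 p = 0.
Proof.
by have := DER_act_linearl (-1) 0 0 p; rewrite scaler0 addr0 scaleN1r addNr.
Qed.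
Lemma DER_pair0r p : DER_pair p 0 = 0.
Proof. by rewrite /DER_pair linear0 add0r. Qed.
Lemma DER_pair0l p : DER_pair 0 p = 0.
Proof. by rewrite DER_pairC DER_pair0r. Qed.
Lemma DER_d10 : DER_d1 (0 : hom (G0 G) (Gm1 G) * gamma (G0 G)) = 0.
Proof.
by have := @DER_d1_linear _ _ G (-1) 0 0; rewrite scaler0 addr0 scaleN1r addNr.
Qed.
Lemma DER_d20 : @DER_d2 _ _ G 0 = 0.
Proof.
by have := @DER_d2_linear _ _ G (-1) 0 0; rewrite scaler0 addr0 scaleN1r addNr.
Qed.

Lemma DER_mkD a a' p p' m m' : @DER_mk _ _ G a p m + DER_mk a' p' m' =
  DER_mk (a + a') (p + p') (m + m').
Proof. exact: gsec_eq. Qed.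
Lemma DER_mkN a p m : - @DER_mk _ _ G a p m = DER_mk (- a) (- p) (- m).
Proof. exact: gsec_eq. Qed.
Lemma DER_mkZ f a p m : f *: @DER_mk _ _ G a p m = DER_mk (f *: a) (f *: p) (f *: m).
Proof. exact: gsec_eq. Qed.
Lemma DER_mk0 : @DER_mk _ _ G 0 0 0 = 0.
Proof. exact: gsec_eq. Qed.

Lemma DER_brE a p m a' p' m' :
  DER_br (@DER_mk _ _ G a p m) (DER_mk a' p' m') =
  DER_mk (der_br a a') (DER_act a p' - DER_act a' p)
    (der_op1 a m' - der_op1 a' m + DER_pair p p').
Proof. by []. Qed.

Lemma DER_dE a p m : DER_d (@DER_mk _ _ G a p m) = DER_mk (DER_d1 p) (DER_d2 m) 0.
Proof. by []. Qed.

(* Otherwise rewriting with DER_brE would unfold the inner bracket of a nested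
   one to find the components that it expects. *)
Local Opaque DER_br DER_d.

Definition zeroE := (der_br0, der_0br, DER_act0r, DER_act0l, DER_pair0r, DER_pair0l,
  DER_d10, DER_d20, @op10, @raddf0, @subr0, @sub0r, @addr0, @add0r, @oppr0, @scaler0).

Lemma DER_br_deg j k x y : homog j x -> homog k y -> homog (j + k) (DER_br x y).
Proof.
move=> /homogE -> /homogE ->.
case: j => [|[|[|j]]]; case: k => [|[|[|k]]]; rewrite -?DER_mk0 DER_brE ?zeroE;
  exact: DER_mk_homog.
Qed.

(** This disposes of all combinations of degrees for which an identity takes
    place in total degree below -2. *)
Lemma homog_ge3 k x : homog k x -> (2 < k)%N -> x = 0.
Proof. by case: k => [|[|[|k]]] // /homogE. Qed.

Lemma DER_br_skew j k x y : homog j x -> homog k y ->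
  DER_br x y = - ((-1) ^+ (j * k) *: DER_br y x).
Proof.
move=> hx hy; have [jk|jk] := ltnP 2 (j + k).
  rewrite (homog_ge3 (DER_br_deg hx hy) jk).
  by rewrite addnC in jk; rewrite (homog_ge3 (DER_br_deg hy hx) jk) scaler0 oppr0.
rewrite (homogE hx) (homogE hy).
case: j jk hx => [|[|[|j]]]; case: k hy => [|[|[|k]]] //= *;
  rewrite !DER_brE ?expr0 ?expr1 ?scale1r ?scaleN1r ?opprK !zeroE ?DER_mkN
    ?zeroE ?opprK //.
- by rewrite der_br_skew.
- by rewrite DER_pairC.
Qed.

Lemma DER_actN d p : DER_act d (- p) = - DER_act d p.
Proof.
have := DER_act_linearr (-1) d p 0.
by rewrite DER_act0r !addr0 cinf_cstN1 !scaleN1r.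
Qed.
Lemma DER_pairNr p q : DER_pair p (- q) = - DER_pair p q.
Proof. by have := DER_pair_linear (-1) p q 0; rewrite !scaleN1r DER_pair0r !addr0. Qed.
Lemma DER_pairNl p q : DER_pair (- p) q = - DER_pair p q.
Proof. by rewrite DER_pairC DER_pairNr DER_pairC. Qed.
Lemma DER_d1N p : DER_d1 (- p) = - DER_d1 p.
Proof. by have := DER_d1_linear (-1) p 0; rewrite !scaleN1r DER_d10 !addr0. Qed.
Lemma DER_d2N m : DER_d2 (- m) = - @DER_d2 _ _ G m.
Proof. by have := @DER_d2_linear _ _ G (-1) m 0; rewrite !scaleN1r DER_d20 !addr0. Qed.

(** Computes both sides of an identity between homogeneous elements component
    by component. *)
Local Ltac graded := rewrite -?DER_mk0 ?(DER_dE, DER_brE) ?DER_mkN ?zeroE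
  ?(expr0, expr1, sqrrN, expr1n, muln0, mul0n, mul1n, muln1, scale1r, scaleN1r) ?opprK
  ?DER_mkN ?DER_mkD ?DER_mk0 ?zeroE ?opprK ?DER_mk0.

Lemma DER_d_br j k x y : homog j x -> homog k y ->
  DER_d (DER_br x y) = DER_br (DER_d x) y + (-1) ^+ j *: DER_br x (DER_d y).
Proof.
move=> /homogE -> /homogE ->.
move: (DER_0 x) (DER_1 x) (DER_2 x) (DER_0 y) (DER_1 y) (DER_2 y).
move=> a p m a' p' m'.
case: j => [|[|[|j]]]; case: k => [|[|[|k]]]; graded => //.
- by rewrite der_br_d1.
- by rewrite DER_act_d2.
- by rewrite DER_d1N der_br_skew der_br_d1.
- by rewrite -DER_act_d1.
- by rewrite op1_d1 subrr DER_mk0.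
- by rewrite DER_d2N DER_act_d2.
- by rewrite DER_pairC op1_d1 subrr DER_mk0.
Qed.

Lemma DER_jacobi j k l x y z : homog j x -> homog k y -> homog l z ->
  DER_br x (DER_br y z) =
    DER_br (DER_br x y) z + (-1) ^+ (j * k) *: DER_br y (DER_br x z).
Proof.
move=> hx hy hz; have [jkl|jkl] := ltnP 2 (j + k + l).
  have jkl' : (2 < k + (j + l))%N by rewrite addnCA addnA.
  rewrite (homog_ge3 (DER_br_deg (DER_br_deg hx hy) hz) jkl).
  rewrite (homog_ge3 (DER_br_deg hy (DER_br_deg hx hz)) jkl') scaler0 addr0.
  by rewrite (homog_ge3 (DER_br_deg hx (DER_br_deg hy hz))) ?addnA.
rewrite (homogE hx) (homogE hy) (homogE hz); move: jkl {hx hy hz}.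
move: (DER_0 x) (DER_1 x) (DER_2 x) (DER_0 y) (DER_1 y) (DER_2 y).
move: (DER_0 z) (DER_1 z) (DER_2 z) => a'' p'' m'' a p m a' p' m'.
case: j => [|[|[|j]]]; case: k => [|[|[|k]]]; case: l => [|[|[|l]]] //= _; graded => //.
- by rewrite der_br_jacobi.
- by rewrite DER_act_br subrK.
- by rewrite op1_br subrK.
- by rewrite DER_actN DER_act_br opprB addKr.
- by rewrite DER_act_pair.
- by rewrite raddfN op1_br opprB addKr.
- by rewrite !DER_actN opprK DER_act_br opprB.
- by rewrite DER_act_pair DER_pairNl addrA addNr add0r.
- rewrite !DER_pairNr opprK DER_act_pair (DER_pairC p').
  by rewrite [in RHS]opprD addrAC addNr add0r.
- by rewrite !raddfN opprK op1_br opprB.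
Qed.

Lemma DER_split x : x = DER_mk (DER_0 x) (DER_1 x) (DER_2 x).
Proof. exact: gsec_eq. Qed.

Lemma DER_d_linear : linear (@DER_d _ _ G).
Proof.
move=> f x y; rewrite [x]DER_split [y]DER_split !(DER_mkZ, DER_mkD, DER_dE).
by rewrite DER_d1_linear DER_d2_linear scaler0 addr0.
Qed.

Lemma DER_d_deg k x : homog k.+1 x -> homog k (DER_d x).
Proof.
move=> /homogE ->; case: k => [|[|k]]; rewrite -?DER_mk0 DER_dE ?zeroE;
  exact: DER_mk_homog.
Qed.

Lemma DER_d_deg0 x : homog 0 x -> DER_d x = 0.
Proof. by move=> /homogE ->; rewrite DER_dE ?zeroE DER_mk0. Qed.

Lemma DER_d_d x : DER_d (DER_d x) = 0.
Proof. by rewrite [x]DER_split !DER_dE DER_d1_d2 DER_d20 DER_mk0. Qed.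

Lemma DER_br_linearr (a : R) x y z :
  DER_br x (cinf_cst a *: y + z) = cinf_cst a *: DER_br x y + DER_br x z.
Proof.
rewrite [x]DER_split [y]DER_split [z]DER_split !(DER_mkZ, DER_mkD, DER_brE).
rewrite der_br_linearr DER_act_linearr DER_act_linearl cdo_linear op1D op1Z.
rewrite DER_pair_linear !scalerBr !scalerDr !scalerN; congr DER_mk.
  by rewrite opprD addrACA.
by rewrite !addrA; apply: gamma_sepP => h; rewrite !(raddfD, raddfN) /=; ring.
Qed.

Lemma DER_br_linearl (a : R) x y z :
  DER_br (cinf_cst a *: x + y) z = cinf_cst a *: DER_br x z + DER_br y z.
Proof.
rewrite [x]DER_split [y]DER_split [z]DER_split !(DER_mkZ, DER_mkD, DER_brE).
rewrite !(der_br_skew _ (DER_0 z)) der_br_linearr DER_act_linearr DER_act_linearl.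
rewrite cdo_linear op1D op1Z !(DER_pairC _ (DER_1 z)) DER_pair_linear.
rewrite !scalerBr !scalerDr !scalerN; congr DER_mk.
- by rewrite opprD.
- by rewrite opprD addrACA.
by apply: gamma_sepP => h; rewrite !(scalerN, opprD, raddfD, raddfN) /=; ring.
Qed.

Lemma DER_br_leibniz (f : C) x y : homog 0 x ->
  DER_br x (f *: y) = f *: DER_br x y + (DER_anchor (x ord0) f : C) *: y.
Proof.
have E (lt03 : (0 < 3)%N) : (x (Ordinal lt03) : der0 G) = DER_0 x.
  by rewrite (bool_irrelevance lt03 isT).
move=> hx; rewrite /DER_anchor (E _).
rewrite [in LHS](homogE hx) [in X in _ = X + _](homogE hx) [y]DER_split.
rewrite !(DER_mkZ, DER_brE) !zeroE DER_mkD.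
by rewrite der_br_leibniz DER_act_leibniz cdo_leibniz -(der_symbol (der0P _)).
Qed.

Lemma DER_anchor_linear : linear (@DER_anchor _ _ G : A ord0 -> vfield M).
Proof. by []. Qed.

Lemma DER_bundle : is_bundle (der0 G) -> forall i, is_bundle (A i).
Proof.
move=> Gb; apply: ord3_ind => //; last exact: is_bundle_gamma.
by apply: is_bundle_prod; [exact: is_bundle_hom|exact: is_bundle_gamma].
Qed.

End Graded.

Theorem theorem3p8 (R : realType) (M : manifold R) (G : lie2 M) :
  is_bundle (der0 G) ->
  is_strict_lie_algebroid (n := 2) (A := @DER R M G)
    (@DER_anchor R M G) (@DER_d R M G) (@DER_br R M G).
Proof.
move=> Gb; split.
- exact: DER_bundle.
- exact: DER_anchor_linear.
- exact: DER_d_linear.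
- exact: DER_d_deg.
- exact: DER_d_deg0.
- exact: DER_br_linearl.
- exact: DER_br_linearr.
- exact: DER_br_deg.
- exact: DER_br_skew.
- exact: DER_d_d.
- exact: DER_d_br.
- exact: DER_jacobi.
- exact: DER_br_leibniz.
Qed.
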